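(* Let $\mathcal L=(l_1,l_2,\ldots)$ be a finite or infinite sequence in $\mathbb N$. Let $\simeq^{M(\mathcal L)}$ be the relation of isometric isomorphism of Polish $\mathcal L$-structures on the standard Borel space $M(\mathcal L)$, and let $\equiv^{M(\mathcal L)}$ be the orbit equivalence relation of the natural action of $\operatorname{Iso}(\mathbb U)$ on $M(\mathcal L)$. Then $\simeq^{M(\mathcal L)}$ is Borel reducible to $\equiv^{M(\mathcal L)}$, i.e. $\simeq^{M(\mathcal L)}\,\leq_B\,\equiv^{M(\mathcal L)}$, and so $\simeq^{M(\mathcal L)}$ is below a group action.
   Context: **Polish structures.** A Polish $\mathcal L$-structure is a triple $\mathbb X=(X,d,(F_n))$ where $(X,d)$ is a separable complete metric space and each $F_n\subseteq X^{l_n}$ is closed in the product topology. Two Polish $\mathcal L$-structures $\mathbb X=(X,d^{\mathbb X},(F_n^{\mathbb X}))$ and $\mathbb Y=(Y,d^{\mathbb Y},(F_n^{\mathbb Y}))$ are isometrically isomorphic if there is an isometric bijection $h:X\to Y$ such that for all $n$ and all $(x_1,\ldots,x_{l_n})\in X^{l_n}$: $(x_1,\ldots,x_{l_n})\in F_n^{\mathbb X}\iff (h(x_1),\ldots,h(x_{l_n}))\in F_n^{\mathbb Y}$. **The space $M(\mathcal L)$.** $(\mathbb U,\delta)$ is the Urysohn metric space, $\operatorname{Iso}(\mathbb U)$ its (Polish) isometry group, and $F(Z)$ is the standard Borel space of closed subsets of a Polish space $Z$ (Effros Borel structure). Let $$M(\mathcal L)=\Big\{(X,(F_n))\in (F(\mathbb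 U)\setminus\{\varnothing\})\times\prod_n F(\mathbb U^{l_n}) : F_n\subseteq X^{l_n}\text{ for all }n\Big\},$$ a Borel set. Each $\mathbb X=(X,(F_n))\in M(\mathcal L)$ is identified with the Polish $\mathcal L$-structure $(X,\delta\restriction X,(F_n))$, and $\mathbb X\simeq^{M(\mathcal L)}\mathbb Y$ means that these structures are isometrically isomorphic. **The action.** $\operatorname{Iso}(\mathbb U)$ acts diagonally on each $\mathbb U^{l_n}$, and hence on $M(\mathcal L)$ by $\sigma\cdot(X,(F_n))=(\sigma\cdot X,(\sigma\cdot F_n))$. Then $\mathbb X\equiv^{M(\mathcal L)}\mathbb Y$ iff $\sigma\cdot\mathbb X=\mathbb Y$ for some $\sigma\in\operatorname{Iso}(\mathbb U)$. **Borel reducibility.** For equivalence relations $E,F$ on standard Borel spaces $X,Y$, $E\le_B F$ means there is a Borel map $\Theta:X\to Y$ with $xEx'\iff\Theta(x)F\Theta(x')$. $E$ is below a group action if it is Borel reducible to the orbit equivalence relation of a Borel action of a Polish group on a standard Borel space. *)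

(* Defs.v *)
From HB Require Import structures.
From mathcomp Require Import all_boot all_order all_algebra.
From mathcomp Require Import all_classical all_reals all_analysis.

Set Implicit Arguments.
Unset Strict Implicit.
Unset Printing Implicit Defensive.

Import Order.TTheory GRing.Theory Num.Theory.

Local Open Scope classical_set_scope.

Definition separable_space (T : topologicalType) : Prop :=
  exists2 D : set T, countable D & dense D.

(* The axiom of [completeType], without the requirement that [T] be pointed. *)
Definition complete_space (T : uniformType) : Prop :=
  forall F : set_system T, ProperFilter F -> cauchy F -> exists l : T, F --> l.

Definition isometric (R : realType) (X Y : metricType R) (f : X -> Y) : Prop :=
  forall x y : X, mdist (f x) (f y) = mdist x y.

Definition polish_space (R : realType) (T : topologicalType) : Prop :=
  exists P : metricType R, [/\ separable_space P, complete_space P &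
    exists2 f : T -> P, bijective f &
      forall A : set P, open A <-> open (f @^-1` A)].

Lemma isometric_continuous (R : realType) (X Y : metricType R) (f : X -> Y) :
  isometric f -> continuous f.
Proof.
move=> fi x; apply/metricType_numDomainType.cvgrPdist_lt => e e0; near=> t.
rewrite fi; near: t.
by apply: (metricType_numDomainType.cvgr_dist_lt (y := x)); [exact: cvg_id|].
Unshelve. all: by end_near. Qed.

Section metric_subspace.
Context {R : realType} {X : metricType R} (A : set X).

Let sub_mdist (x y : set_type A) : R := mdist (\val x) (\val y).

Let sub_mdist_ge0 x y : (0 <= sub_mdist x y)%R.
Proof. exact: mdist_ge0. Qed.

Let sub_mdist_positivity x y : sub_mdist x y = 0%R -> x = y.
Proof. by move=> xy; apply: val_inj; exact: mdist_positivity xy. Qed.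

Let sub_ballEmdist (x : set_type A) (d : R) :
  ball x d = [set y | (sub_mdist x y < d)%R].
Proof.
rewrite -initial_ballE ballEmdist; apply/seteqP.
by split=> y; rewrite /= /sub_mdist set_valE.
Qed.

HB.instance Definition _ := @PseudoMetric_isMetric.Build R (set_type A)
  sub_mdist sub_mdist_ge0 sub_mdist_positivity sub_ballEmdist.

End metric_subspace.

Lemma set_val_isometric (R : realType) (X : metricType R) (A : set X) :
  isometric (\val : set_type A -> X).
Proof. by []. Qed.

Lemma separable_subspace (R : realType) (X : metricType R) (A : set X) :
  separable_space X -> separable_space (set_type A).
Proof.
move=> [D cD dD].
have [[a0 _]|A0] := pselect (exists a : set_type A, True); last first.
  by exists set0 => // O [a] _ _; exfalso; apply: A0; exists a.
pose g (p : nat * X) : set_type A :=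
  if pselect (exists a : set_type A, mdist p.2 (\val a) < p.1.+1%:R^-1)%R
    is left h then projT1 (cid h) else a0.
exists (g @` (setT `*` D)).
  apply: (sub_countable (card_image_le _ _)).
  exact: countableX.
move=> O [a Oa] oO.
have : nbhs a O by exact: open_nbhs_nbhs.
rewrite -nbhs_ballE => -[e /= e0 aeO].
have [n ne] : exists n : nat, (n.+1%:R^-1 < e / 2 :> R)%R.
  have e20 : (0 < e / 2)%R by rewrite divr_gt0.
  have [n _ /(_ n (leqnn n))] := near_infty_natSinv_lt (PosNum e20).
  by exists n.
have [||d [ad Dd]] := dD ((ball (\val a) n.+1%:R^-1%R)°).
- by exists (\val a); exact: nbhsx_ballx.
- exact: open_interior.
have {ad} := interior_subset ad; rewrite ballEmdist /= => ad.
exists (g (n, d)); split; last by exists (n, d).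
apply: aeO; rewrite ballEmdist /= /g; case: pselect => [h|]; last first.
  by case; exists a; rewrite /= metric_sym.
case: cid => b /= db; apply: (le_lt_trans (metric_triangle _ d _)).
by rewrite [ltRHS]splitr ltrD// (lt_trans _ ne).
Qed.

Lemma complete_subspace (R : realType) (X : metricType R) (A : set X) :
  closed A -> complete_space X -> complete_space (set_type A).
Proof.
move=> cA cX F PF cF.
have [l Fl] : exists l : X, \val @ F --> l.
  apply: cX => E; rewrite -entourage_ballE => -[e /= e0 eE].
  have : entourage [set xy : set_type A * set_type A | ball xy.1 e xy.2].
    exact: entourage_ball (PosNum e0).
  move=> /cF [[P Q] [FP FQ]] PQ.
  exists (\val @` P, \val @` Q) => /=.
    by split; [apply: filterS FP|apply: filterS FQ] => x ?; exists x.
  move=> [_ _] [/= [x Px <-] [y Qy <-]]; apply: eE => /=.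
  by have := PQ (x, y) (conj Px Qy); rewrite /= !ballEmdist.
have Al : A l.
  apply: (@closed_cvg _ _ F PF \val A cA _ l Fl).
  by apply: filterE => x; exact: set_valP.
exists (exist _ l (mem_set Al)).
apply/metricType_numDomainType.fcvgrPdist_lt => e e0.
exact: (metricType_numDomainType.cvgr_dist_lt Fl).
Qed.

Lemma ptws_comp_continuous (I : eqType) (X Y : topologicalType) (f : X -> Y) :
  continuous f ->
  continuous ((fun t => f \o t) : {ptws I -> X} -> {ptws I -> Y}).
Proof.
move=> cf x; apply/cvg_sup; first
  exact/fmap_filter/(nbhs_filter (x : {ptws I -> X})).
move=> i B [_ [[C oC <-] Cfx] CB].
have : nbhs (x : {ptws I -> X}) ((@proj I (fun=> X) i) @^-1` (f @^-1` C)).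
  apply: (@proj_continuous I (fun=> X) i x).
  by apply: cf; exact: open_nbhs_nbhs.
by apply: (@filterS _ _ (nbhs_filter (x : {ptws I -> X}))) => y Cy; exact: CB.
Qed.

Lemma closed_preim (X Y : topologicalType) (f : X -> Y) (C : set Y) :
  continuous f -> closed C -> closed (f @^-1` C).
Proof. by move=> cf; apply: preimage_closed => // x _; exact: cf. Qed.

(* The point plays no role; measurable types are pointed in the library. *)
#[short(type="preTopologicalGroupType")]
HB.structure Definition PreTopologicalGroup :=
  {G of Group G & PointedTopological G}.

Definition polish_group (R : realType) (G : preTopologicalGroupType) : Prop :=
  [/\ polish_space R G,
      continuous (fun p : G * G => (p.1 * p.2)%g) &
      continuous (fun g : G => (g^-1)%g)].

Section isometry_group.
Context {R : realType} (U : metricType R).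

Record iso := Iso {
  iso_fun :> U -> U;
  iso_bij : bijective iso_fun;
  iso_isometric : isometric iso_fun }.

Implicit Types s t u : iso.

Lemma iso_ext s t : (forall x, s x = t x) -> s = t.
Proof.
case: s t => [s sb si] [t tb ti] /= /funext st; subst t.
by congr Iso; exact: Prop_irrelevance.
Qed.

HB.instance Definition _ := gen_eqMixin iso.
HB.instance Definition _ := gen_choiceMixin iso.

Definition iso_id : iso :=
  @Iso id (inv_bij (fun=> erefl)) (fun _ _ => erefl).

Lemma iso_comp_isometric s t : isometric (s \o t).
Proof. by move=> x y /=; rewrite !iso_isometric. Qed.

Definition iso_comp s t : iso :=
  @Iso (s \o t) (bij_comp (iso_bij s) (iso_bij t)) (iso_comp_isometric s t).

Lemma iso_inv_ex s : exists t : iso, cancel t s /\ cancel s t.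
Proof.
have [g sK gK] := iso_bij s.
have gi : isometric g by move=> x y; rewrite -(iso_isometric s) !gK.
by exists (@Iso g (Bijective gK sK) gi).
Qed.

Definition iso_inv s : iso := projT1 (cid (iso_inv_ex s)).

Lemma iso_invK s : cancel (iso_inv s) s.
Proof. by rewrite /iso_inv; case: cid => t []. Qed.

Lemma isoK s : cancel s (iso_inv s).
Proof. by rewrite /iso_inv; case: cid => t []. Qed.

Lemma iso_compA : associative iso_comp.
Proof. by move=> s t u; exact: iso_ext. Qed.

Lemma iso_comp1s : left_id iso_id iso_comp.
Proof. by move=> s; exact: iso_ext. Qed.

Lemma iso_comps1 : right_id iso_id iso_comp.
Proof. by move=> s; exact: iso_ext. Qed.

Lemma iso_compVs : left_inverse iso_id iso_inv iso_comp.
Proof. by move=> s; apply: iso_ext => x /=; rewrite isoK. Qed.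

Lemma iso_compsV : right_inverse iso_id iso_inv iso_comp.
Proof. by move=> s; apply: iso_ext => x /=; rewrite iso_invK. Qed.

HB.instance Definition _ :=
  isGroup.Build iso iso_compA iso_comp1s iso_comps1 iso_compVs iso_compsV.

HB.instance Definition _ := isPointed.Build iso iso_id.

(* The topology of pointwise convergence. *)
HB.instance Definition _ := PointedTopological.copy iso
  (initial_topology (iso_fun : iso -> {ptws U -> U})).

End isometry_group.

(* The Urysohn space is characterized, up to isometry, as the separable complete
   metric space that is universal for separable metric spaces and
   ultrahomogeneous. *)
HB.mixin Record isUrysohnSpace (R : realType) U & Metric R U := {
  urysohn_separable : separable_space U;
  urysohn_complete : complete_space U;
  urysohn_universal : forall V : metricType R, separable_space V ->
    exists f : V -> U, isometric f;
  urysohn_homogeneous : forall (A : set U) (f : U -> U), finite_set A ->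
    {in A &, forall x y, mdist (f x) (f y) = mdist x y} ->
    exists s : iso U, {in A, f =1 s}
}.

#[short(type="urysohnSpaceType")]
HB.structure Definition UrysohnSpace (R : realType) :=
  {U of Metric R U & isUrysohnSpace R U}.

Section effros.
Variable Z : topologicalType.

Record closed_set := ClosedSet {
  closed_set_val :> set Z;
  closed_setP : closed closed_set_val }.

Lemma closed_set_inj : injective closed_set_val.
Proof.
move=> [C cC] [D cD] /= CD; subst D; congr ClosedSet; exact: Prop_irrelevance.
Qed.

HB.instance Definition _ := gen_eqMixin closed_set.
HB.instance Definition _ := gen_choiceMixin closed_set.
HB.instance Definition _ := isPointed.Build closed_set (ClosedSet (@closed0 Z)).

Definition effros := g_sigma_algebraType
  [set [set C : closed_set | C `&` O !=set0] | O in @open Z].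

HB.instance Definition _ := Measurable.on effros.

End effros.

Arguments closed_setP {Z} c.

Section dependent_product.
Variables (I : Type) (d : I -> measure_display).
Variable T : forall i, measurableType (d i).

Definition prod_measurable :=
  g_sigma_algebraType (\bigcup_i
    preimage_set_system setT (fun f : forall i, T i => f i) measurable).

HB.instance Definition _ := Measurable.on prod_measurable.

End dependent_product.

(* Arities may be 0: [F_n] is then a subset of the one-point space [U^0]. *)
Inductive signature := FinSignature of seq nat | InfSignature of nat -> nat.

Definition symbol (L : signature) : Type :=
  match L with FinSignature s => 'I_(size s) | InfSignature _ => nat end.
Coercion symbol : signature >-> Sortclass.

Definition arity (L : signature) : L -> nat :=
  match L return L -> nat with
  | FinSignature s => fun n => nth 0 s n
  | InfSignature l => l
  end.

Section polish_structures.
Context {R : realType} {L : signature}.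

Record polish_structure := PolishStructure {
  structure_carrier :> metricType R;
  structure_separable : separable_space structure_carrier;
  structure_complete : complete_space structure_carrier;
  structure_rel : forall n : L, set {ptws 'I_(arity n) -> structure_carrier};
  structure_rel_closed : forall n : L, closed (@structure_rel n) }.

Arguments structure_rel : clear implicits.

Definition isometrically_isomorphic (X Y : polish_structure) : Prop :=
  exists h : X -> Y, [/\ bijective h, isometric h &
    forall (n : L) (x : 'I_(arity n) -> X),
      structure_rel X n x <-> structure_rel Y n (h \o x)].

End polish_structures.
Arguments polish_structure : clear implicits.
Arguments structure_rel {R L} X n : rename.

Section space_of_structures.
Context {R : realType} (U : urysohnSpaceType R) (L : signature).

Definition pre_structure : Type :=
  effros U * prod_measurable (fun n : L => effros {ptws 'I_(arity n) -> U}).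

HB.instance Definition _ := Measurable.on pre_structure.

Definition pre_dom (X : pre_structure) : set U := X.1 : closed_set U.

Definition pre_rel (X : pre_structure) (n : L) :
  set {ptws 'I_(arity n) -> U} := X.2 n : closed_set _.

Arguments pre_rel : clear implicits.

Definition structure_set : set pre_structure :=
  [set X | pre_dom X !=set0 /\
    forall n, pre_rel X n `<=` [set x | forall i, pre_dom X (x i)]].

Lemma urysohn_inhabited : exists x : U, True.
Proof.
have sep : separable_space R^o.
  exists (range (@ratr R)); last exact: dense_rat.
  by apply: (sub_countable (card_image_le _ _)); exact: countableP.
have [f _] := @urysohn_universal R U R^o sep.
by exists (f 0%R).
Qed.

Lemma structure_set_inhabited : exists X, structure_set X.
Proof.
have [x _] := urysohn_inhabited.
exists (ClosedSet closedT, fun n => ClosedSet (@closed0 _)); split.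
  by exists x.
by move=> n y.
Qed.

Definition structure_type : Type := set_type structure_set.

HB.instance Definition _ := Choice.on structure_type.

HB.instance Definition _ := isPointed.Build structure_type
  (let X := cid structure_set_inhabited in
   exist _ (projT1 X) (mem_set (projT2 X))).

(* The trace on [structure_set] of the product Borel structure. *)
Definition structure_space : Type :=
  g_sigma_algebra_preimageType (\val : structure_type -> pre_structure).

HB.instance Definition _ := Measurable.on structure_space.

Implicit Types X Y : structure_space.

Definition struct_dom X : set U := pre_dom (\val X).

Definition struct_rel X (n : L) : set {ptws 'I_(arity n) -> U} :=
  pre_rel (\val X) n.

Arguments struct_rel : clear implicits.

Lemma struct_dom_closed X : closed (struct_dom X).
Proof. exact: closed_setP. Qed.

Lemma struct_dom_neq0 X : struct_dom X !=set0.
Proof. by have /set_mem[] := valP X. Qed.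

Lemma struct_rel_closed X n : closed (struct_rel X n).
Proof. exact: closed_setP. Qed.

Lemma struct_rel_sub X n x : struct_rel X n x -> forall i, struct_dom X (x i).
Proof. by have /set_mem[_] := valP X; apply. Qed.

Definition sub_rel X (n : L) :
    set {ptws 'I_(arity n) -> set_type (struct_dom X)} :=
  [set x | struct_rel X n (fun i => \val (x i))].

Arguments sub_rel : clear implicits.

Lemma sub_rel_closed X n : closed (sub_rel X n).
Proof.
have vc : continuous (\val : set_type (struct_dom X) -> U).
  exact/isometric_continuous/set_val_isometric.
exact: closed_preim (@ptws_comp_continuous _ _ _ _ vc) (@struct_rel_closed X n).
Qed.

Definition to_polish_structure X : polish_structure R L :=
  {| structure_carrier := set_type (struct_dom X);
     structure_separable := separable_subspace (struct_dom X) urysohn_separable;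
     structure_complete :=
       complete_subspace (@struct_dom_closed X) urysohn_complete;
     structure_rel := sub_rel X;
     structure_rel_closed := @sub_rel_closed X |}.

Definition structure_iso X Y : Prop :=
  isometrically_isomorphic (to_polish_structure X) (to_polish_structure Y).

Section action.
Variable s : iso U.

Lemma iso_image_closed (C : closed_set U) : closed (s @` C).
Proof.
suff -> : s @` C = s^-1%g @^-1` C.
  exact: (@closed_preim _ _ _ C
    (isometric_continuous (iso_isometric s^-1%g)) (closed_setP C)).
apply/seteqP; split=> [_ [x Cx <-]|x Cx] /=; first by rewrite isoK.
by exists (s^-1%g x) => //; rewrite iso_invK.
Qed.

Lemma iso_image_tuple_closed l (C : closed_set {ptws 'I_l -> U}) :
  closed [set (s \o x : {ptws 'I_l -> U}) | x in C].
Proof.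
set D := (X in closed X).
suff -> : D = (fun x : {ptws 'I_l -> U} => s^-1%g \o x) @^-1` C.
  apply: (closed_preim _ (closed_setP C)); apply: ptws_comp_continuous.
  exact/isometric_continuous/iso_isometric.
apply/seteqP; split=> [_ [x Cx <-]|x Cx] /=.
  by rewrite compA (_ : _ \o _ = id)//; apply/funext => y; exact: isoK.
by exists (s^-1%g \o x) => //; apply/funext => i; exact: iso_invK.
Qed.

Definition pre_act (X : pre_structure) : pre_structure :=
  (ClosedSet (@iso_image_closed X.1),
   fun n => ClosedSet (@iso_image_tuple_closed (arity n) (X.2 n))).

Lemma pre_act_structure X : structure_set (pre_act (\val X)).
Proof.
split.
  by have [x Xx] := struct_dom_neq0 X; exists (s x); exists x.
by move=> n _ [x Xx <-] i; exists (x i) => //; exact: (struct_rel_sub Xx).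
Qed.

Definition structure_act X : structure_space :=
  exist _ (pre_act (\val X)) (mem_set (@pre_act_structure X)).

End action.

End space_of_structures.

Arguments pre_rel {R U L} X n.
Arguments struct_rel {R U L} X n.
Arguments sub_rel {R U L} X n.

Definition orbit_equivalence (G : groupType) (Y : Type) (act : G -> Y -> Y)
    (x y : Y) : Prop :=
  exists g, act g x = y.

Definition is_group_action (G : groupType) (Y : Type)
    (act : G -> Y -> Y) : Prop :=
  (forall x, act 1%g x = x) /\
  (forall g h x, act (g * h)%g x = act g (act h x)).

Definition borel (T : ptopologicalType) := g_sigma_algebraType (@open T).

HB.instance Definition _ (T : ptopologicalType) := Measurable.on (borel T).

Definition standard_borel (R : realType) d (Y : measurableType d) : Prop :=
  exists P : metricType R, [/\ separable_space P, complete_space P &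
    exists2 f : Y -> P, bijective f &
      forall A : set P, <<s @open P >> A <-> measurable (f @^-1` A)].

Definition borel_reducible d d' (X : measurableType d) (Y : measurableType d')
    (E : X -> X -> Prop) (F : Y -> Y -> Prop) : Prop :=
  exists2 f : X -> Y, measurable_fun setT f &
    forall x x', E x x' <-> F (f x) (f x').

Definition below_group_action (R : realType) d (X : measurableType d)
    (E : X -> X -> Prop) : Prop :=
  exists (G : preTopologicalGroupType) d' (Y : measurableType d')
      (act : G -> Y -> Y),
    [/\ polish_group R G, standard_borel R Y, is_group_action act,
        measurable_fun setT (fun p : borel G * Y => act p.1 p.2) &
        borel_reducible E (orbit_equivalence act)].

(* Main.v *)
Require Import Defs.
From HB Require Import structures.
From mathcomp Require Import all_boot all_order all_algebra.
From mathcomp Require Import all_classical all_reals all_analysis.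
From mathcomp Require Import measurable_realfun.
From mathcomp Require Import lra.

Set Implicit Arguments.
Unset Strict Implicit.
Unset Printing Implicit Defensive.

Import Order.TTheory GRing.Theory Num.Theory numFieldNormedType.Exports.

Local Open Scope classical_set_scope.
Local Open Scope ring_scope.

(** The reduction moves the domain of a structure to a position in the Urysohn
    space [U] in which isomorphisms extend to isometries of [U].

    Call a subset [S] of [U] generic when it sits in [U] as a space sits in the
    Urysohn space built from it by iterating Katetov extensions: the distance
    functions of points of [U] to [S] are uniform limits of finitely supported
    Katetov functions, and all such functions are realized, also relative to
    finitely many more points.  If [S] and [T] are generic, the distances from a
    point to [S], carried over to [T] by an isometry, are again distances to a
    point; hence every isometry from [S] onto [T] extends to [U] by
    back-and-forth ([generic_extends]).

    Instead of building a tower of extensions of [S] and identifying its limit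
    with [U], one embeds [S] into [U] directly.  Let [x] be a dense sequence of
    [S] and [q] one of [U].  The points [e 0], [e 1], ... are chosen inductively
    in [U] with the mutual distances of [x 0], [x 1], ..., and [e n] is put as far
    as possible from a long initial segment of [q], as in the free amalgam over
    [e 0], ..., [e n.-1].  Then distances from [q j] to the copy are supported on
    finitely many [e i]; choosing the segments long enough makes all the required
    functions appear ([independent_growth_generic]).  Each choice can be made in a
    Borel way by the selection theorem of Kuratowski and Ryll-Nardzewski
    ([measurable_selection]), because by Katetov extension it is decided by
    finitely many distances whether a ball contains a suitable point
    ([measurable_generic_embedding]).  Transporting the relations gives a Borel
    map [F] with [F X] isomorphic to [X] and with generic domain.  For such
    structures, isomorphism is the orbit equivalence relation of the isometry
    group ([structure_iso_reduces]).

    The isometry group is Polish, as an isometry and its inverse are coded by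
    their values on [q] and the codes form a closed set of sequences
    ([iso_polish_group]).  For the second claim, a structure is replaced by the
    function giving the distance of a tuple to its domain or to one of its
    relations.  This is an equivariant, injective and Borel map to the space of
    1-Lipschitz functions, a closed set of sequences of reals once functions are
    restricted to a dense sequence, on which the isometry group acts in a Borel
    way ([structure_act_below]). *)

(** * Preliminaries on metric spaces *)

Lemma countable_enum (T : Type) (D : set T) (y0 : T) : countable D ->
  exists q : nat -> T, forall y, D y -> exists n, q n = y.
Proof.
move=> /countable_injP[f fi].
pose P n y := D y /\ f y = n.
have /choice[q qP] n : exists y, (exists z, P n z) -> P n y.
  by have [[z Pz]|nz] := pselect (exists z, P n z); [exists z|exists y0].
exists q => y Dy; exists (f y).
have [Dq fq] := qP (f y) (ex_intro _ y (conj Dy erefl)).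
by apply: fi fq; exact/mem_set.
Qed.

(** Dependent choice with access to the whole history: [good n f a] may look at
    [f] below [n] only.  While [f n] is being chosen, the later values are [a0],
    which is why an invariant of single values can be assumed at every index. *)
Lemma history_choice (A : Type) (a0 : A) (Inv : A -> Prop)
    (good : nat -> (nat -> A) -> A -> Prop) :
  Inv a0 ->
  (forall n f g a, (forall i, (i < n)%N -> f i = g i) -> good n f a -> good n g a) ->
  (forall n f, (forall i, Inv (f i)) ->
    (forall i, (i < n)%N -> good i f (f i)) -> exists2 a, Inv a & good n f a) ->
  exists f, forall n, Inv (f n) /\ good n f (f n).
Proof.
move=> Inv0 good_ext step.
have /choice[next nextP] (nf : nat * (nat -> A)) : exists a,
    (forall i, Inv (nf.2 i)) ->
    (forall i, (i < nf.1)%N -> good i nf.2 (nf.2 i)) -> Inv a /\ good nf.1 nf.2 a.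
  case: nf => n f /=; have [[If gf]|no] := pselect ((forall i, Inv (f i)) /\
      forall i, (i < n)%N -> good i f (f i)); last by exists a0 => If gf; case: no.
  by have [a Ia ga] := step n f If gf; exists a.
pose F := fix F n : nat -> A :=
  if n is m.+1 then fun i => if i == m then next (m, F m) else F m i
  else fun=> a0.
have F_stable n i m : (i < n)%N -> (n <= m)%N -> F m i = F n i.
  move=> iN /subnKC <-; elim: (m - n)%N => [|k IH]; first by rewrite addn0.
  by rewrite addnS /= ifN// neq_ltn ltn_addr.
pose f i := F i.+1 i.
have Ff n i : (i < n)%N -> F n i = f i by move=> iN; exact: F_stable.
have FP n : (forall i, Inv (F n i)) /\ forall i, (i < n)%N -> good i (F n) (F n i).
  elim: n => [|n [IF gF]]; first by split.
  have [In gn] := nextP (n, F n) IF gF.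
  split=> [i|i]; first by rewrite /=; case: ifP => _ //; exact: IF.
  rewrite ltnS leq_eqVlt => iN.
  apply: (@good_ext i (F n)) => [j ji|].
    have jn : (j < n)%N by case/predU1P: iN => [<-|/(ltn_trans ji)].
    by rewrite /= ifN// neq_ltn jn.
  case/predU1P: iN => [->|iN] /=; first by rewrite eqxx.
  by rewrite ifN ?neq_ltn ?iN//; exact: gF.
exists f => n; have [IF gF] := FP n.+1; split; first exact: IF.
have := gF n (ltnSn n); apply: good_ext => i iN.
by rewrite Ff// ltnW.
Qed.

Lemma uniform_bound (T : eqType) (s : seq T) (P : T -> nat -> Prop) :
  (forall x m n, (m <= n)%N -> P x m -> P x n) ->
  (forall x, x \in s -> exists n, P x n) ->
  exists n, forall x, x \in s -> P x n.
Proof.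
move=> Pmono; elim: s => [|x s IH] Ps; first by exists 0%N.
have [n nP] : exists n, forall y, y \in s -> P y n.
  by apply: IH => y sy; apply: Ps; rewrite inE sy orbT.
have [m mP] := Ps x (mem_head _ _).
exists (maxn m n) => y; rewrite inE => /predU1P[->|/nP].
  exact: Pmono (leq_maxl _ _) mP.
exact: Pmono (leq_maxr _ _).
Qed.

Lemma set_mem_cons (T : eqType) (x : T) (s : seq T) :
  [set` x :: s] = x |` [set` s].
Proof.
by apply/seteqP; split=> y /=; rewrite inE => /predU1P.
Qed.

Section metric_basics.
Context {R : realType} {X : metricType R}.
Implicit Types x y z : X.

Definition dense_seq (q : nat -> X) :=
  forall x (e : R), 0 < e -> exists n, mdist x (q n) < e.

Lemma separable_dense_seq (x0 : X) :
  separable_space X -> exists q : nat -> X, dense_seq q.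
Proof.
move=> [D cD dD].
have near_D x (e : R) : 0 < e -> exists2 y, D y & mdist x y < e.
  move=> e0; have [||y [xy Dy]] := dD ((ball x e)°).
  - by exists x; exact: nbhsx_ballx.
  - exact: open_interior.
  by exists y => //; move: (interior_subset xy); rewrite ballEmdist.
have [y0 Dy0 _] := near_D x0 1 ltr01.
have [q qD] := countable_enum y0 cD.
by exists q => x e /(near_D x)[y /qD[n <-] xy]; exists n.
Qed.

Lemma dense_seq_separable (q : nat -> X) : dense_seq q -> separable_space X.
Proof.
move=> dq; exists (range q).
  by apply: (sub_countable (card_image_le _ _)); exact: countableP.
move=> O [a Oa] oO.
have : nbhs a O by exact: open_nbhs_nbhs.
rewrite -nbhs_ballE => -[e /= e0 aO].
have [n an] := dq a e e0; exists (q n); split; last by exists n.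
by apply: aO; rewrite ballEmdist.
Qed.

Lemma le_of_approx (a b : R) : (forall e, 0 < e -> a <= b + e) -> a <= b.
Proof. by move=> h; apply/ler_addgt0Pr. Qed.

Lemma mdist_abs_sub x y z : `|mdist x z - mdist y z| <= mdist x y.
Proof.
have h1 := metric_triangle x y z; have h2 := metric_triangle y x z.
rewrite ler_norml (metric_sym y x) in h2 *; apply/andP; split; lra.
Qed.

Lemma half_expS n : (2^-1 : R) ^+ n = 2 * 2^-1 ^+ n.+1.
Proof. by rewrite exprS mulrA divff ?mul1r. Qed.

Lemma half_exp_gt0 n : 0 < (2^-1 : R) ^+ n.
Proof. by rewrite exprn_gt0. Qed.

Lemma half_exp_small (e : R) : 0 < e -> exists n, 2^-1 ^+ n < e.
Proof.
move=> e0; have : (fun n => (2^-1 : R) ^+ n) n @[n --> \oo] --> (0 : R).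
  by apply: cvg_expr; rewrite ger0_norm// invf_lt1// ltr1n.
move=> /cvgrPdist_lt /(_ e e0)[n _ /(_ n (leqnn n))] /=.
by rewrite sub0r normrN ger0_norm ?exprn_ge0// => h; exists n.
Qed.

(** Distances at most $2^{-n}$ between consecutive terms sum up to at most
    $2 \cdot 2^{-n}$ from the $n$-th term on. *)
Lemma geometric_cvg (u : nat -> X) : complete_space X ->
  (forall n, mdist (u n) (u n.+1) <= 2^-1 ^+ n) ->
  exists l, forall n, mdist (u n) l <= 2 * 2^-1 ^+ n.
Proof.
move=> cX uS.
have u_le n k : mdist (u n) (u (n + k)%N) <= 2 * 2^-1 ^+ n - 2 * 2^-1 ^+ (n + k).
  elim: k => [|k IH]; first by rewrite addn0 mdistxx subrr.
  have := metric_triangle (u n) (u (n + k)%N) (u (n + k).+1).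
  by have := uS (n + k)%N; have := half_expS (n + k)%N; rewrite addnS; lra.
have u_lt n m : (n <= m)%N -> mdist (u n) (u m) < 2 * 2^-1 ^+ n.
  move=> nm; have := u_le n (m - n)%N; rewrite subnKC//.
  have := half_exp_gt0 m; lra.
have [l ul] : exists l : X, u @ \oo --> l.
  apply: cX => A; rewrite -entourage_ballE => -[e /= e0 eA].
  have [|n ne] := @half_exp_small (e / 4); first by lra.
  exists (u @` [set m | (n <= m)%N], u @` [set m | (n <= m)%N]) => /=.
    by split; exists n => // m /= nm; exists m.
  move=> [_ _] [/= [i ni <-] [j nj <-]]; apply: eA => /=; rewrite ballEmdist/=.
  have := metric_triangle (u i) (u n) (u j); rewrite (metric_sym (u i) (u n)).
  have := u_lt _ _ ni; have := u_lt _ _ nj; lra.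
exists l => n; apply: le_of_approx => e e0.
have [N _ /(_ (maxn N n) (leq_maxl _ _))/=] :=
  metricType_numDomainType.cvgr_dist_lt ul e0.
set m := maxn N n; have nm : (n <= m)%N by rewrite leq_maxr.
have := metric_triangle (u n) (u m) l; rewrite (metric_sym (u m)).
have := u_lt _ _ nm; lra.
Qed.

(** Improving an approximate solution step by step, each time moving it by at
    most $2^{-n}$, gives a limit. *)
Lemma approx_limit (P : nat -> X -> Prop) (x0 : X) : complete_space X ->
  P 0%N x0 ->
  (forall n x, P n x -> exists2 y, P n.+1 y & mdist x y <= 2^-1 ^+ n) ->
  exists u : nat -> X, exists l,
    forall n, P n (u n) /\ mdist (u n) l <= 2 * 2^-1 ^+ n.
Proof.
move=> cX Px0 step.
have /choice[g gP] (nx : nat * X) : exists y,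
    P nx.1 nx.2 -> P nx.1.+1 y /\ mdist nx.2 y <= 2^-1 ^+ nx.1.
  have [p|np] := pselect (P nx.1 nx.2); last by exists x0.
  by have [y ? ?] := step _ _ p; exists y.
pose u := fix u n := if n is m.+1 then g (m, u m) else x0.
have uP n : P n (u n) by elim: n => //= n IH; exact: (gP (n, u n) IH).1.
have [|l ul] := @geometric_cvg u cX.
  by move=> n; exact: (gP (n, u n) (uP n)).2.
by exists u, l.
Qed.

Lemma open_mball x (r : R) : open [set y | mdist x y < r].
Proof.
rewrite openE => y xy; rewrite /interior -nbhs_ballE.
exists (r - mdist x y) => /=; first by rewrite subr_gt0.
move=> z; rewrite ballEmdist /= => yz.
by have := metric_triangle x y z; lra.
Qed.

Lemma closed_mdist (C : set X) x : closed C ->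
  (forall r : R, 0 < r -> exists2 u, C u & mdist x u < r) -> C x.
Proof.
move=> cC Cx; apply: cC => A; rewrite -nbhs_ballE => -[r /= r0 xA].
have [u Cu xu] := Cx r r0; exists u; split => //.
by apply: xA; rewrite ballEmdist.
Qed.

Lemma closure_mdist (A : set X) x (r : R) : 0 < r ->
  closure A x -> exists2 y, A y & mdist x y < r.
Proof.
move=> r0 /(_ _ (nbhsx_ballx x r r0))[y [Ay]].
by rewrite ballEmdist; exists y.
Qed.

Lemma closure_range (e : nat -> X) x (r : R) : closure (range e) x -> 0 < r ->
  exists i, mdist x (e i) < r.
Proof.
move=> ex r0; have [_ [[i _ <-]]] := ex _ (nbhsx_ballx x r r0).
by rewrite ballEmdist; exists i.
Qed.

Lemma closed_equidistant (I : Type)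
    (P : I -> Prop) (a : I -> X) (r : I -> R) :
  closed [set u | forall i, P i -> mdist u (a i) = r i].
Proof.
move=> u uC i Pi; apply/eqP; rewrite -subr_eq0 -normr_eq0 eq_le normr_ge0 andbT.
apply: le_of_approx => t t0; rewrite add0r.
have [v [/(_ i Pi) <-]] := uC _ (nbhsx_ballx u t t0).
by rewrite ballEmdist /= => uv; have := mdist_abs_sub u v (a i); lra.
Qed.

End metric_basics.
Arguments half_expS : clear implicits.
Arguments half_exp_gt0 : clear implicits.

(** The first index is kept apart because the empty list has no minimum. *)
Definition listmin (R : realType) (I : Type) (F : I -> R) (i0 : I) (s : seq I) :=
  \big[Num.min/F i0]_(i <- s) F i.

Section listmin.
Context {R : realType} {I : eqType}.
Implicit Types (F : I -> R) (s : seq I).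

Lemma listmin_le F i0 s i : i \in i0 :: s -> listmin F i0 s <= F i.
Proof.
rewrite /listmin; elim: s => [|j s IH].
  by rewrite mem_seq1 => /eqP ->; rewrite big_nil.
rewrite big_cons ge_min !inE => /or3P[i_i0|/eqP ->|si].
- by rewrite IH ?orbT// inE i_i0.
- by rewrite lexx.
- by rewrite IH ?orbT// inE si orbT.
Qed.

Lemma listmin_mem F i0 s : exists2 i, i \in i0 :: s & listmin F i0 s = F i.
Proof.
rewrite /listmin; elim: s => [|j s [i is_ Hi]].
  by exists i0; rewrite ?big_nil// mem_seq1.
rewrite big_cons; case: (leP (F j)) => _.
  by exists j; rewrite // !inE eqxx orbT.
by exists i => //; move: is_; rewrite !inE => /orP[->//|->]; rewrite !orbT.
Qed.

Lemma eq_listmin (F G : I -> R) i0 s :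
  {in i0 :: s, F =1 G} -> listmin F i0 s = listmin G i0 s.
Proof.
move=> FG; rewrite /listmin FG ?mem_head//; apply: eq_big_seq => i si.
by rewrite FG// inE si orbT.
Qed.

End listmin.

Lemma listmin_map (R : realType) (I J : Type) (F : I -> R) (h : J -> I) j0 s :
  listmin F (h j0) (map h s) = listmin (F \o h) j0 s.
Proof. by rewrite /listmin big_map. Qed.

(** * Katetov functions and the extension property of the Urysohn space *)

(** The functions that can be the distance to a point of a larger metric
    space. *)
Definition katetov (R : realType) (X : metricType R) (S : set X) (f : X -> R) :=
  forall x y, S x -> S y -> f x <= f y + mdist x y /\ mdist x y <= f x + f y.

Section katetov_hull.
Context {R : realType} {X : metricType R}.
Implicit Types (f : X -> R) (B : seq X).

Lemma katetov_mdist (S : set X) (z : X) : katetov S (mdist z).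
Proof.
move=> x y _ _; have := metric_triangle z y x; rewrite (metric_sym y x) => h1.
by have := metric_triangle x z y; rewrite (metric_sym x z).
Qed.

Lemma katetov_ge0 (S : set X) f x : katetov S f -> S x -> 0 <= f x.
Proof. by move=> fK Sx; have [_] := fK x x Sx Sx; rewrite mdistxx; lra. Qed.

(** For a Katetov function [f] on [b0 :: B], the largest extension whose values
    grow no faster than the distance; it is the function that Katetov calls
    supported on [b0 :: B]. *)
Definition hull f b0 B x : R := listmin (fun b => f b + mdist b x) b0 B.

Lemma hull_le f b0 B b x : b \in b0 :: B -> hull f b0 B x <= f b + mdist b x.
Proof. exact: listmin_le. Qed.

Lemma hull_mem f b0 B x :
  exists2 b, b \in b0 :: B & hull f b0 B x = f b + mdist b x.
Proof. exact: listmin_mem. Qed.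

Lemma hull_eq f b0 B b : katetov [set` b0 :: B] f -> b \in b0 :: B ->
  hull f b0 B b = f b.
Proof.
move=> fK Bb; apply/eqP; rewrite eq_le; apply/andP; split.
  by have := hull_le f b Bb; rewrite mdistxx addr0.
have [c Bc ->] := hull_mem f b0 B b.
by have [] := fK b c Bb Bc; rewrite (metric_sym b).
Qed.

Lemma hull_lip f b0 B x y : hull f b0 B x <= hull f b0 B y + mdist x y.
Proof.
have [c Bc ->] := hull_mem f b0 B y.
apply: le_trans (hull_le f x Bc) _.
by have := metric_triangle c y x; rewrite (metric_sym y x); lra.
Qed.

Lemma hull_katetov f b0 B : katetov [set` b0 :: B] f ->
  katetov setT (hull f b0 B).
Proof.
move=> fK x y _ _; split; first exact: hull_lip.
have [c Bc ->] := hull_mem f b0 B x; have [e Be ->] := hull_mem f b0 B y.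
have [_ ce] := fK c e Bc Be.
have := metric_triangle x c y; have := metric_triangle c e y.
by rewrite (metric_sym x c); lra.
Qed.

Lemma katetov_le_hull (S : set X) f b0 B x : katetov S f ->
  [set` b0 :: B] `<=` S -> S x -> f x <= hull f b0 B x.
Proof.
move=> fK BS Sx; have [c Bc ->] := hull_mem f b0 B x.
by have [] := fK x c Sx (BS _ Bc); rewrite (metric_sym x).
Qed.

End katetov_hull.

Section one_point_extension.
Context {R : realType} {X : metricType R} (f : X -> R).
Hypotheses (fK : katetov setT f) (f_gt0 : forall x, 0 < f x).

Definition one_point of katetov setT f & (forall x, 0 < f x) : Type := option X.
Local Notation X1 := (one_point fK f_gt0).

HB.instance Definition _ := Choice.copy X1 (option X).

Definition one_point_dist (a b : X1) : R :=
  match a, b with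
  | Some x, Some y => mdist x y
  | Some x, None | None, Some x => f x
  | None, None => 0
  end.

Let dist_xx a : one_point_dist a a = 0.
Proof. by case: a => //= x; rewrite mdistxx. Qed.

Let dist_positivity a b : one_point_dist a b = 0 -> a = b.
Proof.
case: a b => [x|] [y|] //=; first by move/mdist_positivity ->.
  by move=> fx; have := f_gt0 x; rewrite fx ltxx.
by move=> fx; have := f_gt0 y; rewrite fx ltxx.
Qed.

Let dist_sym a b : one_point_dist a b = one_point_dist b a.
Proof. by case: a b => [x|] [y|] //=; rewrite metric_sym. Qed.

Let dist_triangle b a c :
  one_point_dist a c <= one_point_dist a b + one_point_dist b c.
Proof.
case: a b c => [x|] [y|] [z|] /=; rewrite ?addr0 ?add0r//.
- exact: metric_triangle.
- by have [+ _] := fK (x := x) (y := y) I I; lra.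
- by have [_] := fK (x := x) (y := z) I I.
- by have [+ _] := fK (x := z) (y := y) I I; rewrite (metric_sym z); lra.
- by have := ltW (f_gt0 y); lra.
Qed.

HB.instance Definition _ :=
  isMetric.Build R X1 dist_xx dist_positivity dist_sym dist_triangle.

Lemma one_point_separable (q : nat -> X) : dense_seq q -> separable_space X1.
Proof.
move=> dq; pose p n : X1 := if n is m.+1 then Some (q m) else None.
apply: (@dense_seq_separable _ _ p) => -[x|] e e0.
  by have [n xn] := dq x e e0; exists n.+1.
by exists 0%N; rewrite mdistxx.
Qed.

End one_point_extension.

(** Universality embeds the space [U] together with a point at the distances
    prescribed by [f], and homogeneity moves the embedded copy of the finite
    set [B] back onto [B]. *)
Lemma urysohn_realize (R : realType) (U : urysohnSpaceType R) (B : seq U)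
    (f : U -> R) : katetov [set` B] f ->
  exists z : U, forall b, b \in B -> mdist z b = f b.
Proof.
case: B => [|b0 B] fK; first by have [z _] := urysohn_inhabited U; exists z.
have gK := hull_katetov fK; set g := hull f b0 B in gK.
have [[b gb0]|g_neq0] := pselect (exists b, g b = 0).
  exists b => c Bc; rewrite -(hull_eq fK Bc) -/g.
  have [+ _] := gK c b I I; have [_] := gK b c I I; rewrite gb0 (metric_sym c).
  by move=> *; apply/eqP; rewrite eq_le; apply/andP; split; lra.
have g_gt0 x : 0 < g x.
  rewrite lt_neqAle (katetov_ge0 gK)// andbT eq_sym.
  by apply/eqP => gx; apply: g_neq0; exists x.
have [q dq] := separable_dense_seq b0 (@urysohn_separable R U).
have [j ji] := @urysohn_universal R U _ (one_point_separable gK g_gt0 dq).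
pose i (x : U) := j (Some x : one_point gK g_gt0).
have i_isom x y : mdist (i x) (i y) = mdist x y by rewrite /i ji.
have /choice[p pP] (y : U) : exists x, (exists2 b, b \in b0 :: B & i b = y) ->
    x \in b0 :: B /\ i x = y.
  have [[x Bx xy]|ny] := pselect (exists2 b, b \in b0 :: B & i b = y).
    by exists x.
  by exists y => /ny.
have [||s sP] := @urysohn_homogeneous R U (i @` [set` b0 :: B]) p.
- exact/finite_image/finite_seq.
- move=> _ _ /set_mem[x Bx <-] /set_mem[y By <-].
  have [_ ix] := pP (i x) (ex_intro2 _ _ x Bx erefl).
  have [_ iy] := pP (i y) (ex_intro2 _ _ y By erefl).
  by rewrite -i_isom ix iy.
exists (s (j (None : one_point gK g_gt0))) => b Bb.
have [_ ib] := pP (i b) (ex_intro2 _ _ b Bb erefl).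
have pib : p (i b) = b.
  by apply: mdist_positivity; rewrite -i_isom ib mdistxx.
rewrite -[X in mdist _ X]pib sP; last by apply/mem_set; exists b.
by rewrite iso_isometric ji /= -(hull_eq fK Bb).
Qed.

(** Homogeneity extends the finite map [a i |-> b i] to an isometry, which
    carries [p] to the required point. *)
Lemma finite_isometric_image (R : realType) (U : urysohnSpaceType R)
    (a b : nat -> U) n p :
  (forall i j, (i < n)%N -> (j < n)%N -> mdist (b i) (b j) = mdist (a i) (a j)) ->
  exists p', forall i, (i < n)%N -> mdist p' (b i) = mdist p (a i).
Proof.
move=> ab; pose A := a @` [set i | (i < n)%N].
have /choice[f fP] y : exists z, A y -> exists i, [/\ (i < n)%N, a i = y & z = b i].
  have [[i iN ai]|nA] := pselect (A y); last by exists y.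
  by exists (b i) => _; exists i.
have fa i : (i < n)%N -> f (a i) = b i.
  move=> iN; have [|j [jn aj ->]] := fP (a i); first by exists i.
  by apply: mdist_positivity; rewrite ab// aj mdistxx.
have [||s sP] := @urysohn_homogeneous R U A f.
- exact/finite_image/finite_II.
- by move=> _ _ /set_mem[i iN <-] /set_mem[j jn <-]; rewrite !fa// ab.
exists (s p) => i iN; rewrite -fa// sP ?iso_isometric//.
by apply/mem_set; exists i.
Qed.

(** * Subspaces in general position and back-and-forth *)

Section generic_position.
Context {R : realType} {U : urysohnSpaceType R}.
Implicit Types (S T : set U) (f : U -> R) (B F : seq U).

Definition nearly_supported T f := forall e : R, 0 < e ->
  exists b0 B, [set` b0 :: B] `<=` T /\
    forall x, T x -> hull f b0 B x <= f x + e.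

(** This is how a space [S] sits in the Urysohn space obtained from it by
    iterating Katetov's one-point extensions: distance functions of points of
    [U] to [S] are limits of finitely supported ones, and every finitely
    supported one occurs up to any positive error, also relative to finitely many
    further points. *)
Definition generic S :=
  (forall z, nearly_supported S (mdist z)) /\
  (forall F b0 B f (e : R), [set` b0 :: B] `<=` S `|` [set` F] ->
    katetov [set` b0 :: B] f -> 0 < e ->
    exists z, forall x, (S `|` [set` F]) x ->
      `|mdist z x - hull f b0 B x| <= e).

(** The new value is the supremum of the errors [|d(z,x) - f(x)|], the least one
    allowed by the triangle inequality. *)
Lemma katetov_extend T f z (r : R) : T !=set0 -> katetov T f ->
  (forall x, T x -> `|mdist z x - f x| <= r) ->
  exists g, [/\ katetov (z |` T) g, forall x, T x -> g x = f x & g z <= r].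
Proof.
move=> [t0 Tt0] fK zr.
pose E := (fun x => `|mdist z x - f x|) @` T.
have Esup : has_sup E.
  split; first by exists `|mdist z t0 - f t0|, t0.
  by exists r => _ [x Tx <-]; exact: zr.
have E_le x : T x -> `|mdist z x - f x| <= sup E.
  by move=> Tx; apply: sup_upper_bound => //; exists x.
have le_E (c : R) : (forall x, T x -> `|mdist z x - f x| <= c) -> sup E <= c.
  by move=> h; apply: ge_sup; [exact: Esup.1|move=> _ [x Tx <-]; exact: h].
have sup_le x : T x -> sup E <= f x + mdist z x.
  move=> Tx; apply: le_E => y Ty; have [xy1 xy2] := fK y x Ty Tx.
  have := metric_triangle x z y; have := metric_triangle z x y.
  rewrite (metric_sym x z) (metric_sym y x) in xy1 xy2 *.
  by move=> *; rewrite ler_norml; apply/andP; split; lra.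
exists (fun x => if x == z then sup E else f x); split.
- have main x : T x -> [/\ f x <= sup E + mdist x z, sup E <= f x + mdist z x &
      mdist x z <= f x + sup E].
    move=> Tx; have := E_le x Tx; rewrite ler_norml (metric_sym x) => /andP[? ?].
    by split; [lra|exact: sup_le|lra].
  have sup0 : 0 <= sup E by apply: le_trans (E_le _ Tt0).
  move=> x y [->|Tx] [->|Ty]; rewrite ?eqxx ?mdistxx.
  + by split; lra.
  + case: eqP => [->|_]; first by rewrite mdistxx; split; lra.
    by have [] := main y Ty; rewrite (metric_sym y); split; lra.
  + case: eqP => [->|_]; first by rewrite mdistxx; split; lra.
    by have [] := main x Tx; split; lra.
  + case: eqP => [->|_]; case: eqP => [->|_]; rewrite ?mdistxx.
    * by split; lra.
    * by have [] := main y Ty; rewrite (metric_sym y); split; lra.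
    * by have [] := main x Tx; split; lra.
    * exact: fK.
- move=> x Tx; case: eqP => // xz.
  have := E_le x Tx; have := sup_le x Tx; rewrite -xz mdistxx sub0r normrN.
  have := katetov_ge0 fK Tx => f0; rewrite ger0_norm// => *.
  by apply/eqP; rewrite eq_le; apply/andP; split; lra.
- by rewrite eqxx; exact: le_E.
Qed.

(** Genericity only gives approximate realizations.  Given one with error at most
    [2^-(n+1)], the point found is added to the problem, at a distance which
    [katetov_extend] bounds by the error; a better realization of the extended
    problem is then close to the previous one, and a limit exists. *)
Lemma generic_realize S F f : generic S -> S !=set0 ->
  katetov (S `|` [set` F]) f -> nearly_supported (S `|` [set` F]) f ->
  exists z, forall x, (S `|` [set` F]) x -> mdist z x = f x.
Proof.
move=> [_ S_approx] [s0 Ss0]; set T := S `|` _ => fK fsupp.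
pose P n z := forall x, T x -> `|mdist z x - f x| <= 2^-1 ^+ n.+1.
have [z0 Pz0] : exists z, P 0%N z.
  have [|b0 [B [BT Bf]]] := fsupp (2^-1 ^+ 2); first exact: half_exp_gt0.
  have [||z zB] := S_approx F b0 B f (2^-1 ^+ 2) BT; last 1 first.
  - exists z => x Tx; have := zB x Tx; have := Bf x Tx.
    have := katetov_le_hull fK BT Tx; rewrite (half_expS R 1).
    by rewrite !ler_norml => ? ? /andP[? ?]; apply/andP; split; lra.
  - by move=> x y /BT Tx /BT Ty; exact: fK.
  - exact: half_exp_gt0.
have step n z : P n z -> exists2 z', P n.+1 z' & mdist z z' <= 2^-1 ^+ n.
  move=> Pz; have [|g [gK gf gz]] := katetov_extend _ fK Pz.
    by exists s0; left.
  have [|b0 [B [BT Bf]]] := fsupp (2^-1 ^+ n.+3); first exact: half_exp_gt0.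
  have BzT : [set` z :: b0 :: B] `<=` z |` T.
    by move=> x /=; rewrite inE => /predU1P[->|/BT]; [left|right].
  have zT_F : z |` T = S `|` [set` z :: F].
    by rewrite set_mem_cons setUCA.
  have gf_hull x : T x -> hull g z (b0 :: B) x <= hull f b0 B x.
    move=> Tx; have [c Bc ->] := hull_mem f b0 B x.
    by rewrite -gf; [apply: hull_le; rewrite inE Bc orbT|exact: BT].
  have [|||z' z'B] := S_approx (z :: F) z (b0 :: B) g (2^-1 ^+ n.+3).
  - by rewrite -zT_F.
  - by move=> x y /BzT zx /BzT zy; exact: gK.
  - exact: half_exp_gt0.
  rewrite -zT_F in z'B.
  exists z' => [x Tx|].
    have := z'B x (or_intror Tx); have := gf_hull x Tx; have := Bf x Tx.
    have := katetov_le_hull gK BzT (or_intror Tx); rewrite (half_expS R n.+2).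
    by rewrite gf// !ler_norml => ? ? ? /andP[? ?]; apply/andP; split; lra.
  have := z'B z (or_introl erefl).
  rewrite hull_eq ?mem_head//; last by move=> x y /BzT zx /BzT zy; exact: gK.
  rewrite ler_norml => /andP[_]; rewrite metric_sym.
  have := half_expS R n; have := half_expS R n.+1; have := half_expS R n.+2.
  have := half_exp_gt0 R n.+3; lra.
have [u [z uz]] := approx_limit (@urysohn_complete R U) Pz0 step.
exists z => x Tx; apply/eqP; rewrite -subr_eq0 -normr_eq0 eq_le normr_ge0 andbT.
apply: le_of_approx => e e0.
have [|n ne] := @half_exp_small R (e / 4); first by lra.
have [/(_ x Tx) ux unz] := uz n; rewrite add0r.
have := mdist_abs_sub z (u n) x; rewrite (metric_sym z (u n)).
have := half_expS R n; have := half_exp_gt0 R n.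
move: ux; rewrite !ler_norml => /andP[? ?] ? ? /andP[? ?].
by apply/andP; split; lra.
Qed.

Definition isometric_graph (G : set (U * U)) :=
  forall p q, G p -> G q -> mdist p.1 q.1 = mdist p.2 q.2.

(** The partial isometries of the back-and-forth argument. *)
Definition finite_extension S T (G : set (U * U)) :=
  isometric_graph G /\ exists F F' : seq U,
    fst @` G = S `|` [set` F] /\ snd @` G = T `|` [set` F'].

Definition graph_inv (G : set (U * U)) : set (U * U) := [set p | G (p.2, p.1)].

Lemma finite_extension_inv S T G :
  finite_extension S T G -> finite_extension T S (graph_inv G).
Proof.
move=> [Gi [F [F' [GF GF']]]]; split.
  by move=> p q Gp Gq; rewrite (Gi _ _ Gp Gq).
exists F', F; rewrite -GF -GF'; split.
  by apply/seteqP; split=> [_ [[x y] /= Gp <-]|_ [[x y] /= Gp <-]];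
    exists (y, x).
by apply/seteqP; split=> [_ [[x y] /= Gp <-]|_ [[x y] /= Gp <-]];
  exists (y, x).
Qed.

(** The distances from [z] to the domain, read on the range, form a Katetov
    function; it is nearly supported because [S] is generic, hence the distance
    to some point because [T] is. *)
Lemma finite_extension_forth S T G z : generic S -> generic T -> T !=set0 ->
  finite_extension S T G -> exists w, finite_extension S T ((z, w) |` G).
Proof.
move=> Sgen Tgen T0 [Gi [F [F' [GF GF']]]].
have G_inj x x' y : G (x, y) -> G (x', y) -> x = x'.
  move=> Gxy Gx'y; apply: mdist_positivity.
  by rewrite (Gi _ _ Gxy Gx'y) mdistxx.
have /choice[g gP] (y : U) : exists x, (T `|` [set` F']) y -> G (x, y).
  have [|nT] := pselect ((T `|` [set` F']) y); last by exists y.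
  by rewrite -GF' => -[[x y'] Gxy /= <-]; exists x.
have /choice[k kP] (x : U) : exists y, (S `|` [set` F]) x -> G (x, y).
  have [|nS] := pselect ((S `|` [set` F]) x); last by exists x.
  by rewrite -GF => -[[x' y] Gxy /= <-]; exists y.
have gS y : (T `|` [set` F']) y -> (S `|` [set` F]) (g y).
  by move=> /gP Gy; rewrite -GF; exists (g y, y).
have kT x : (S `|` [set` F]) x -> (T `|` [set` F']) (k x).
  by move=> /kP Gx; rewrite -GF'; exists (x, k x).
have gK y y' : (T `|` [set` F']) y -> (T `|` [set` F']) y' ->
    mdist (g y) (g y') = mdist y y'.
  by move=> /gP Gy /gP Gy'; exact: (Gi _ _ Gy Gy').
have kgK x : (S `|` [set` F]) x -> g (k x) = x.
  by move=> Sx; apply: (@G_inj _ _ (k x)); [exact/gP/kT|exact: kP].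
have [w wP] : exists w, forall y, (T `|` [set` F']) y ->
    mdist w y = mdist z (g y).
  apply: generic_realize => //.
  - move=> x y Tx Ty; rewrite -(gK x y)//.
    exact: (@katetov_mdist _ _ setT z (g x) (g y)).
  - move=> e e0; have [b0 [B [BS Bz]]] := Sgen.1 z e e0.
    have BFS x : x \in b0 :: B ++ F -> (S `|` [set` F]) x.
      by rewrite -cat_cons mem_cat => /orP[/BS|]; [left|right].
    exists (k b0), (map k (B ++ F)); split.
      by move=> y; rewrite /= -map_cons => /mapP[x /BFS Sx ->]; exact: kT.
    move=> y Ty; have Sy := gS y Ty.
    suff [c Bc cy] : exists2 c, c \in b0 :: B ++ F &
        mdist z c + mdist c (g y) <= mdist z (g y) + e.
      have Sc := BFS c Bc.
      apply: le_trans cy; apply: le_trans (hull_le (b := k c) _ _ _) _.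
        by rewrite -map_cons map_f.
      by rewrite kgK// -(gK (k c))// ?kgK//; exact: kT.
    case: Sy => [Sy|Fy].
      have [c Bc cy] := hull_mem (mdist z) b0 B (g y); exists c.
        by rewrite -cat_cons mem_cat Bc.
      by rewrite -cy; exact: Bz.
    exists (g y); first by rewrite -cat_cons mem_cat Fy orbT.
    by rewrite mdistxx; lra.
exists w; split.
  have new x y : G (x, y) -> mdist z x = mdist w y.
    move=> Gxy; have Ty : (T `|` [set` F']) y by rewrite -GF'; exists (x, y).
    by rewrite wP//; congr mdist; exact: (G_inj _ _ _ Gxy (gP y Ty)).
  move=> [x y] [x' y'] [[-> ->]|Gxy] [[-> ->]|Gx'y'] /=.
  - by rewrite !mdistxx.
  - exact: new.
  - by rewrite metric_sym [RHS]metric_sym; exact: new.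
  - exact: (Gi _ _ Gxy Gx'y').
exists (z :: F), (w :: F'); rewrite !image_setU !image_set1 GF GF' /=.
by split; rewrite set_mem_cons setUCA.
Qed.

Lemma finite_extension_back S T G w : generic S -> generic T -> S !=set0 ->
  finite_extension S T G -> exists z, finite_extension S T ((z, w) |` G).
Proof.
move=> Sgen Tgen S0 /finite_extension_inv Gext.
have [z /finite_extension_inv Hext] := finite_extension_forth w Tgen Sgen S0 Gext.
exists z; congr (finite_extension S T _): Hext.
by apply/seteqP; split=> -[x y] /= [[-> ->]|?]; [left|right|left|right].
Qed.

(** The images of points that approach [x] form a Cauchy sequence. *)
Lemma isometric_graph_image (G : set (U * U)) x : isometric_graph G ->
  (forall e : R, 0 < e -> exists2 p, G p & mdist x p.1 < e) ->
  exists y, forall p, G p -> mdist y p.2 = mdist x p.1.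
Proof.
move=> Gi G1.
have /choice[p pP] n : exists p, G p /\ mdist x p.1 < 2^-1 ^+ n.+2.
  by have [p Gp xp] := G1 _ (half_exp_gt0 R n.+2); exists p.
have [n|y yP] := @geometric_cvg _ _ (fun n => (p n).2) (@urysohn_complete R U).
  have [Gp xp] := pP n; have [Gp' xp'] := pP n.+1.
  rewrite -(Gi _ _ Gp Gp'); have := metric_triangle (p n).1 x (p n.+1).1.
  have := half_expS R n; have := half_expS R n.+1; have := half_expS R n.+2.
  by have := half_exp_gt0 R n.+3; rewrite (metric_sym (p n).1 x); lra.
exists y => q Gq; apply/eqP; rewrite -subr_eq0 -normr_eq0 eq_le normr_ge0 andbT.
apply: le_of_approx => e e0; have [|n ne] := @half_exp_small R (e / 4).
  by lra.
have [Gp xp] := pP n; have pq := Gi _ _ Gp Gq.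
have := mdist_abs_sub y (p n).2 q.2; have := mdist_abs_sub x (p n).1 q.1.
rewrite -pq (metric_sym y (p n).2); have := yP n.
have := half_expS R n; have := half_expS R n.+1; have := half_exp_gt0 R n.+2.
rewrite add0r !ler_norml => ? ? ? ? /andP[? ?] /andP[? ?].
by apply/andP; split; lra.
Qed.

(** By completeness, each point has an image at the right distances from the
    second coordinates of the graph; both coordinates being dense, these images
    form an isometry and the same construction backwards is its inverse. *)
Lemma dense_isometric_graph (G : set (U * U)) : isometric_graph G ->
  (forall x (e : R), 0 < e -> exists2 p, G p & mdist x p.1 < e) ->
  (forall y (e : R), 0 < e -> exists2 p, G p & mdist y p.2 < e) ->
  exists s : iso U, forall p, G p -> s p.1 = p.2.
Proof.
move=> Gi G1 G2.
have Gi' : isometric_graph (graph_inv G).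
  by move=> p q Gp Gq; rewrite (Gi _ _ Gp Gq).
have /choice[s sP] x := isometric_graph_image Gi (G1 x).
have /choice[t tP] y : exists x, forall p, graph_inv G p ->
    mdist x p.2 = mdist y p.1.
  apply: isometric_graph_image Gi' _ => e /(G2 y)[[a b] Gab yb].
  by exists (b, a).
have stK : cancel t s.
  move=> y; apply: mdist_positivity; apply/eqP.
  rewrite eq_le mdist_ge0 andbT; apply: le_of_approx => e e0.
  have [|p Gp yp] := G2 y (e / 2); first by lra.
  have := metric_triangle (s (t y)) p.2 y; rewrite sP// (metric_sym p.2 y).
  by have := tP y (p.2, p.1); rewrite /graph_inv/= -surjective_pairing => ->//; lra.
have tsK : cancel s t.
  move=> x; apply: mdist_positivity; apply/eqP.
  rewrite eq_le mdist_ge0 andbT; apply: le_of_approx => e e0.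
  have [|p Gp xp] := G1 x (e / 2); first by lra.
  have := metric_triangle (t (s x)) p.1 x; rewrite (metric_sym p.1 x).
  have := tP (s x) (p.2, p.1); rewrite /graph_inv/= -surjective_pairing => ->//.
  by rewrite sP//; lra.
have si : isometric s.
  move=> x y; apply/eqP; rewrite -subr_eq0 -normr_eq0 eq_le normr_ge0 andbT.
  apply: le_of_approx => e e0; have [|p Gp yp] := G1 y (e / 2); first by lra.
  have := mdist_abs_sub y p.1 x; have := mdist_abs_sub (s y) p.2 (s x).
  rewrite (metric_sym p.2 (s x)) (metric_sym p.1 x) !sP//.
  rewrite add0r (metric_sym (s y) (s x)) (metric_sym y x) !ler_norml => /andP[? ?] /andP[? ?].
  by apply/andP; split; lra.
exists (Iso (Bijective tsK stK) si) => p Gp /=.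
by apply: mdist_positivity; rewrite sP// mdistxx.
Qed.

(** Back-and-forth: points of a dense sequence are put in turn into the domain
    and the range of a finite extension of the given isometry. *)
Lemma generic_extends S T (G : set (U * U)) : generic S -> generic T ->
  S !=set0 -> T !=set0 -> isometric_graph G -> fst @` G = S -> snd @` G = T ->
  exists s : iso U, forall p, G p -> s p.1 = p.2.
Proof.
move=> Sgen Tgen S0 T0 Gi G1 G2.
have [u0 _] := urysohn_inhabited U.
have [q dq] := separable_dense_seq u0 (@urysohn_separable R U).
have /choice[next nextP] (nH : nat * set (U * U)) : exists H,
    finite_extension S T nH.2 -> [/\ finite_extension S T H, nH.2 `<=` H,
      exists w, H (q nH.1, w) & exists z, H (z, q nH.1)].
  have [ext|next] := pselect (finite_extension S T nH.2); last by exists set0.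
  have [w ext1] := finite_extension_forth (q nH.1) Sgen Tgen T0 ext.
  have [z ext2] := finite_extension_back (q nH.1) Sgen Tgen S0 ext1.
  exists ((z, q nH.1) |` ((q nH.1, w) |` nH.2)); split => //.
  - by move=> p ?; right; right.
  - by exists w; right; left.
  - by exists z; left.
pose H := fix H n := if n is m.+1 then next (m, H m) else G.
have H_ext n : finite_extension S T (H n).
  elim: n => [|n /(nextP (n, H n))[]//]; split => //.
  by exists [::], [::]; rewrite G1 G2 !set_nil !setU0.
have H_le n m : (n <= m)%N -> H n `<=` H m.
  move=> /subnKC <-; elim: (m - n)%N => [|k IH]; first by rewrite addn0.
  rewrite addnS; apply: subset_trans IH _.
  by have [] := nextP (n + k, H (n + k))%N (H_ext _).
have [|||s sP] := @dense_isometric_graph (\bigcup_n H n).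
- move=> p r [n _ Hp] [m _ Hr]; apply: (H_ext (maxn n m)).1.
    exact: H_le (leq_maxl _ _) _ Hp.
  exact: H_le (leq_maxr _ _) _ Hr.
- move=> x e /(dq x)[n xn]; have [_ _ [w Hw] _] := nextP (n, H n) (H_ext n).
  by exists (q n, w) => //; exists n.+1.
- move=> y e /(dq y)[n yn]; have [_ _ _ [z Hz]] := nextP (n, H n) (H_ext n).
  by exists (z, q n) => //; exists n.+1.
by exists s => p Gp; apply: sP; exists 0%N.
Qed.

End generic_position.

(** * Measurable points and measurable selection *)

Section measurable_prop.
Context d (W : measurableType d) (R : realType).
Implicit Types (P Q : W -> Prop) (f g : W -> R).

(** Events are handled as predicates, so that their measurability follows the
    connectives and the countable quantifiers of their definition. *)
Definition mprop P := measurable [set w | P w].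

Lemma mprop_eq P Q : (forall w, P w <-> Q w) -> mprop Q -> mprop P.
Proof.
by move=> PQ; rewrite /mprop (_ : [set w | P w] = [set w | Q w])//;
  apply/seteqP; split=> w /PQ.
Qed.

Lemma mprop_cst (P : Prop) : mprop (fun=> P).
Proof.
have [p|np] := pselect P.
  by apply: (@mprop_eq _ (fun=> True)) => //; exact: measurableT.
by apply: (@mprop_eq _ (fun=> False)) => //; exact: measurable0.
Qed.

Lemma mprop_and P Q : mprop P -> mprop Q -> mprop (fun w => P w /\ Q w).
Proof. exact: measurableI. Qed.

Lemma mprop_not P : mprop P -> mprop (fun w => ~ P w).
Proof. exact: measurableC. Qed.

Lemma mprop_imp P Q : mprop P -> mprop Q -> mprop (fun w => P w -> Q w).
Proof.
move=> mP mQ; apply: (@mprop_eq _ (fun w => ~ (P w /\ ~ Q w))).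
  move=> w; split=> [PQ [/PQ]//|nPQ p]; apply: contrapT => nq; exact: nPQ.
by apply/mprop_not/mprop_and => //; exact: mprop_not.
Qed.

Lemma mprop_if (P : Prop) (Q : W -> Prop) :
  (P -> mprop Q) -> mprop (fun w => P -> Q w).
Proof.
move=> PQ; have [p|np] := pselect P.
  by apply: mprop_imp; [exact: mprop_cst|exact: PQ].
by apply: (@mprop_eq _ (fun=> True)) => //; exact: mprop_cst.
Qed.

Lemma mprop_ex (T : countType) (P : T -> W -> Prop) :
  (forall t, mprop (P t)) -> mprop (fun w => exists t, P t w).
Proof.
move=> mP; suff -> : mprop (fun w => exists t, P t w) =
    measurable (\bigcup_t [set w | P t w]).
  exact: countable_bigcupT_measurable (countableP _) _.
by rewrite /mprop; congr measurable; apply/seteqP; split=> w [] t;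
  [exists t|move=> _ ?; exists t].
Qed.

Lemma mprop_all (T : countType) (P : T -> W -> Prop) :
  (forall t, mprop (P t)) -> mprop (fun w => forall t, P t w).
Proof.
move=> mP; apply: (@mprop_eq _ (fun w => ~ exists t, ~ P t w)).
  move=> w; split=> [h [t]//|nP t]; apply: contrapT => nPt; apply: nP.
  by exists t.
by apply/mprop_not/mprop_ex => t; exact: mprop_not.
Qed.

Definition mreal f := measurable_fun setT f.

Lemma mprop_lt f g : mreal f -> mreal g -> mprop (fun w => f w < g w).
Proof.
move=> mf mg; have := measurable_fun_ltr mf mg measurableT (Y := [set true]).
by rewrite setTI; exact.
Qed.

Lemma mprop_le f g : mreal f -> mreal g -> mprop (fun w => f w <= g w).
Proof.
move=> mf mg; have := measurable_fun_ler mf mg measurableT (Y := [set true]).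
by rewrite setTI; exact.
Qed.

Lemma mreal_cst (c : R) : mreal (fun=> c). Proof. exact: measurable_cst. Qed.

Lemma mreal_lt f : (forall r, mprop (fun w => f w < r)) -> mreal f.
Proof.
move=> mf; apply: (measurability _ (RGenInftyO.measurableE R)) => //.
by move=> _ [_ [r ->] <-]; rewrite setTI preimage_itvNyo; exact: mf.
Qed.

Lemma mreal_sub (f g : W -> R) : mreal f -> mreal g -> mreal (fun w => f w - g w).
Proof. by move=> mf mg; exact: measurable_funB mf mg. Qed.

Lemma mreal_add (f g : W -> R) : mreal f -> mreal g -> mreal (fun w => f w + g w).
Proof. by move=> mf mg; exact: measurable_funD mf mg. Qed.

Lemma mreal_abs (f : W -> R) : mreal f -> mreal (fun w => `|f w|).
Proof. by move=> mf; exact: measurableT_comp. Qed.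

Lemma mreal_listmin (I : Type) (F : I -> W -> R) i0 s :
  (forall i, mreal (F i)) -> mreal (fun w => listmin (F^~ w) i0 s).
Proof.
move=> mF; rewrite /listmin; elim: s => [|i s IH].
  by under eq_fun do rewrite big_nil; exact: mF.
by under eq_fun do rewrite big_cons; exact: measurable_minr (mF i) IH.
Qed.

Definition mindex (s : W -> nat) := forall k, mprop (fun w => s w = k).

Lemma mprop_index (s : W -> nat) (P : nat -> W -> Prop) :
  mindex s -> (forall k, mprop (P k)) -> mprop (fun w => P (s w) w).
Proof.
move=> ms mP; apply: (@mprop_eq _ (fun w => exists k, s w = k /\ P k w)).
  by move=> w; split=> [?|[k [<-]]//]; exists (s w).
by apply: mprop_ex => k; exact: mprop_and.
Qed.

Lemma least_index (P : nat -> W -> Prop) : (forall w, exists k, P k w) ->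
  (forall k, mprop (P k)) ->
  exists2 s, mindex s & forall w, P (s w) w.
Proof.
move=> Pex mP.
have /choice[s sP] w : exists k, P k w /\ forall i, P i w -> (k <= i)%N.
  have ex : exists k, `[< P k w >] by have [k Pk] := Pex w; exists k; exact/asboolP.
  case: (ex_minnP ex) => k /asboolP Pk kmin; exists k; split=> // i Pi.
  exact/kmin/asboolP.
exists s => [k|w]; last by have [] := sP w.
apply: (@mprop_eq _ (fun w => P k w /\ forall i, (i < k)%N -> ~ P i w)).
  move=> w; have [Ps smin] := sP w; split=> [<-|[Pk kmin]].
    by split=> // i ik /smin; rewrite leqNgt ik.
  apply/eqP; rewrite eqn_leq smin//= leqNgt; apply/negP => sk.
  exact: kmin sk Ps.
apply: mprop_and => //; apply: mprop_all => i.
by apply: mprop_imp; [exact: mprop_cst|exact: mprop_not].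
Qed.

End measurable_prop.

Section measurable_point.
Context d (W : measurableType d) (R : realType) (X : metricType R).
Variable q : nat -> X.
Hypothesis dq : dense_seq q.
Implicit Types e : W -> X.

(** Borel measurability of a map to the separable space [X], tested on the
    distances to a dense sequence. *)
Definition mpoint e := forall k, mreal (fun w => mdist (e w) (q k)).

Lemma mpoint_cst x : mpoint (fun=> x).
Proof. by move=> k; exact: mreal_cst. Qed.

Lemma mreal_dist e e' : mpoint e -> mpoint e' ->
  mreal (fun w => mdist (e w) (e' w)).
Proof.
move=> me me'; apply: mreal_lt => r.
(* the triangle inequality is almost an equality at a point of [q] near [e w] *)
apply: (@mprop_eq _ _ _
    (fun w => exists k, mdist (e w) (q k) + mdist (e' w) (q k) < r)).
  move=> w; split=> [ee'|[k]].
    have [|k ek] := dq (e w) (e := (r - mdist (e w) (e' w)) / 2); first by lra.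
    exists k; have := metric_triangle (e' w) (e w) (q k).
    by rewrite (metric_sym (e' w) (e w)); lra.
  have := metric_triangle (e w) (q k) (e' w).
  by rewrite (metric_sym (q k)); lra.
apply: mprop_ex => k; apply: mprop_lt; last exact: mreal_cst.
exact: measurable_funD (me k) (me' k).
Qed.

Lemma mprop_open e (O : set X) : mpoint e -> open O -> mprop (fun w => O (e w)).
Proof.
move=> me oO; apply: (@mprop_eq _ _ _ (fun w => exists k : nat, exists m : nat,
    mdist (e w) (q k) < 2^-1 ^+ m /\ [set y | mdist (q k) y < 2^-1 ^+ m] `<=` O)).
  move=> w; split=> [Oe|[k [m [ek]]]]; last by apply; rewrite /= metric_sym.
  have : nbhs (e w) O by exact: open_nbhs_nbhs.
  rewrite -nbhs_ballE => -[r /= r0 rO].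
  have [|m mr] := @half_exp_small R (r / 2); first by lra.
  have [k ek] := dq (e w) (half_exp_gt0 R m); exists k, m; split=> // y /= ky.
  apply: rO; rewrite ballEmdist /=; have := metric_triangle (e w) (q k) y; lra.
apply: mprop_ex => k; apply: mprop_ex => m; apply: mprop_and.
  exact: mprop_lt (me k) (@mreal_cst _ W R (2^-1 ^+ m)).
exact: mprop_cst.
Qed.

(** This is the selection theorem of Kuratowski and Ryll-Nardzewski; [hit k n]
    may be any measurable event between the ones that the open ball and that the
    closed ball of center [q k] and radius [2^-n] meets [C w].  The
    selected point is the limit of the first points of the dense sequence that
    are close enough to the previous one and to [C w]. *)
Lemma measurable_selection (C : W -> set X) (hit : nat -> nat -> W -> Prop) :
  complete_space X -> (forall w, closed (C w)) -> (forall w, C w !=set0) ->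
  (forall k n, mprop (hit k n)) ->
  (forall w k n u, C w u -> mdist u (q k) < 2^-1 ^+ n -> hit k n w) ->
  (forall w k n, hit k n w -> exists2 u, C w u & mdist u (q k) <= 2^-1 ^+ n) ->
  exists2 e, mpoint e & forall w, C w (e w).
Proof.
move=> cX clC C0 mhit hitI hitE.
(* the radius is [2^-(n+2)] at step [n], so that steps are shorter than [2^-n] *)
have /choice[next nextP] (ns : nat * (W -> nat)) : exists s,
    mindex ns.2 -> (forall w, hit (ns.2 w) ns.1.+2 w) ->
    [/\ mindex s, forall w, hit (s w) ns.1.+3 w &
      forall w, mdist (q (ns.2 w)) (q (s w)) <= 2^-1 ^+ ns.1].
  case: ns => n s /=; have [[ms hs]|no] :=
    pselect (mindex s /\ forall w, hit (s w) n.+2 w); last first.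
    by exists s => ? ?; case: no.
  have [||t mt tP] := @least_index _ W (fun k w => hit k n.+3 w /\
      mdist (q (s w)) (q k) <= 2^-1 ^+ n).
  - move=> w; have [u Cu us] := hitE _ _ _ (hs w).
    have [k uk] := dq u (half_exp_gt0 R n.+3); exists k; split.
      exact: hitI Cu uk.
    have := metric_triangle (q (s w)) u (q k); rewrite (metric_sym (q (s w)) u).
    have := half_expS R n; have := half_expS R n.+1; have := half_expS R n.+2.
    by have := half_exp_gt0 R n.+3; lra.
  - move=> k; apply: mprop_and => //.
    apply: (@mprop_index _ W s (fun i _ => mdist (q i) (q k) <= 2^-1 ^+ n)) => //.
    by move=> i; exact: mprop_cst.
  by exists t => _ _; split=> // w; have [] := tP w.
have [||s0 ms0 hs0] := @least_index _ W (fun k => hit k 2).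
- move=> w; have [u Cu] := C0 w.
  by have [k uk] := dq u (half_exp_gt0 R 2); exists k; exact: hitI Cu uk.
- by [].
pose s := fix s n := if n is m.+1 then next (m, s m) else s0.
have sP n : mindex (s n) /\ forall w, hit (s n w) n.+2 w.
  elim: n => [|n [ms hs]]; first by split.
  by have [] := nextP (n, s n) ms hs.
have /choice[e eP] w : exists l, forall n,
    mdist (q (s n w)) l <= 2 * 2^-1 ^+ n.
  apply: (@geometric_cvg _ _ (fun n => q (s n w)) cX) => n; have [ms hs] := sP n.
  by have [_ _ near_s] := nextP (n, s n) ms hs; exact: near_s.
exists e => [k|w].
  apply: mreal_lt => r.
  apply: (@mprop_eq _ _ _ (fun w => exists n,
      mdist (q (s n w)) (q k) + 2 * 2^-1 ^+ n < r)).
    move=> w; split=> [er|[n]].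
      have [|n nr] := @half_exp_small R ((r - mdist (e w) (q k)) / 4).
        by lra.
      exists n; have := metric_triangle (q (s n w)) (e w) (q k).
      by have := eP w n; lra.
    have := metric_triangle (e w) (q (s n w)) (q k); have := eP w n.
    by rewrite (metric_sym (e w) (q (s n w))); lra.
  apply: mprop_ex => n.
  apply: (@mprop_index _ W (s n)
    (fun i _ => mdist (q i) (q k) + 2 * 2^-1 ^+ n < r) (sP n).1).
  by move=> i; exact: mprop_cst.
apply: closed_mdist (clC w) _ => r r0.
have [|n nr] := @half_exp_small R (r / 4); first by lra.
have [u Cu us] := hitE _ _ _ ((sP n).2 w); exists u => //.
have := metric_triangle (e w) (q (s n w)) u; have := eP w n.
rewrite (metric_sym (e w) (q (s n w))) (metric_sym (q _) u).
have := half_expS R n; have := half_expS R n.+1.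
by have := half_exp_gt0 R n.+2; lra.
Qed.

End measurable_point.

(** * A measurable generic embedding *)

Section generic_sequence.
Context {R : realType} {U : urysohnSpaceType R}.
Variable q : nat -> U.
Hypothesis dq : dense_seq q.
Implicit Types (e : nat -> U) (N : nat -> nat).

Definition basepoints e m := [seq e i | i <- iota 0 m] ++ [seq q i | i <- iota 0 m].

(** The point [q k], seen through its distances to the first [m] points of [e]
    and [q] only. *)
Definition shadow e k m : U -> R := hull (mdist (q k)) (q 0%N) (basepoints e m).

(** The [N n] first points of [q] are those that the points [e n], [e n.+1], ...
    keep at the largest distance compatible with [e 0], ..., [e n.-1]; among
    them, every [shadow e k m] with [k], [m] smaller than [n] is realized up to
    [2^-n] on the first [n] points of [e] and [q]. *)
Definition independent_growth e N :=
  [/\ forall n, (n <= N n)%N, forall i n, (i <= n)%N -> (N i <= N n)%N,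
    forall n j, (0 < n)%N -> (j < N n)%N ->
      exists2 i, (i < n)%N & mdist (q j) (e i) + mdist (e i) (e n) <=
                             mdist (q j) (e n) &
    forall n k m, (k < n)%N -> (m < n)%N -> exists2 j, (j < N n)%N &
      forall i, (i < n)%N ->
        `|mdist (q j) (e i) - shadow e k m (e i)| <= 2^-1 ^+ n /\
        `|mdist (q j) (q i) - shadow e k m (q i)| <= 2^-1 ^+ n].

Lemma mem_basepointsl e m i : (i < m)%N -> e i \in basepoints e m.
Proof. by move=> im; rewrite mem_cat map_f// mem_iota. Qed.

Lemma mem_basepointsr e m i : (i < m)%N -> q i \in basepoints e m.
Proof. by move=> im; rewrite mem_cat orbC map_f// mem_iota. Qed.

Lemma basepointsP e m x : x \in basepoints e m ->
  exists2 i, (i < m)%N & x = e i \/ x = q i.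
Proof.
by rewrite mem_cat => /orP[] /mapP[i]; rewrite mem_iota => im ->; exists i => //;
  [left|right].
Qed.

(** If [e m] is as far from [q j] as its distances to earlier terms allow, then so
    it is already with respect to the first [n] terms, by induction on [m]. *)
Lemma independent_growth_free e N n j : independent_growth e N ->
  (0 < n)%N -> (j < N n)%N -> forall m, exists2 i, (i < n)%N &
    mdist (q j) (e i) + mdist (e i) (e m) <= mdist (q j) (e m).
Proof.
move=> [_ Nmono free _] n0 jn; elim/ltn_ind => m IH.
have [mn|nm] := ltnP m n; first by exists m => //; rewrite mdistxx addr0.
have [|i im jim] := free m j (leq_trans n0 nm).
  exact: leq_trans jn (Nmono _ _ nm).
have [l ln jli] := IH i im; exists l => //.
by have := metric_triangle (e l) (e i) (e m); lra.
Qed.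

(** The distances from [q j], with [j < N n], to the closure of [range e] are
    supported on the first [n] points of [e]; as [q] is dense, distance functions
    of all points are nearly supported.  Conversely, a function supported on [B]
    is the distance to a point [z] on any finite set, [z] is replaced by some
    [q k], and [B] by points among the first [m] ones of [e] and [q]; a [q j] that
    realizes [shadow e k m] at a stage [n > k, m] is at the right distance from
    the first [n] points of [e], hence from all of them. *)
Lemma independent_growth_generic e N : independent_growth e N ->
  generic (closure (range e)).
Proof.
move=> growth; have free := independent_growth_free growth.
have [N_ge _ _ rich] := growth.
split=> [z r r0|F b0 B f r BS fK r0].
  have [|j zj] := dq z (e := r / 4); first by lra.
  have jN : (j < N j.+1)%N by exact: N_ge.
  exists (e 0%N), [seq e i | i <- iota 0 j.+1]; split.
    rewrite set_mem_cons => x [->|/mapP[i _ ->]].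
      by apply: subset_closure; exists 0%N.
    by apply: subset_closure; exists i.
  move=> x ex; have [|m xm] := closure_range ex (r := r / 4); first by lra.
  have [i ij jim] := free j.+1 j (ltn0Sn _) jN m.
  apply: le_trans (hull_le (b := e i) _ _ _) _.
    by rewrite inE map_f ?orbT// mem_iota.
  have := metric_triangle z (q j) (e i); have := metric_triangle (e i) (e m) x.
  have := metric_triangle (q j) z (e m); have := metric_triangle z x (e m).
  by rewrite (metric_sym (q j) z) (metric_sym (e m) x); lra.
pose g := hull f b0 B; have gK : katetov setT g := hull_katetov fK.
(* the errors below add up to at most [8 * c] *)
pose c := r / 16; have c0 : 0 < c by rewrite /c; lra.
have [m mP] : exists m, forall b, b \in b0 :: B ++ F ->
    exists2 a, a \in basepoints e m & mdist b a < c.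
  apply: uniform_bound.
    move=> x m n mn [a /basepointsP[i im ai] xa]; exists a => //.
    have iN := leq_trans im mn.
    by case: ai => ->; [exact: mem_basepointsl|exact: mem_basepointsr].
  move=> b; rewrite -cat_cons mem_cat => bBF.
  have [/closure_range/(_ c0)[i bi]|_] : closure (range e) b \/ b \in F.
    by case/orP: bBF => [/BS[|]|]; [left|right|right].
  - by exists i.+1, (e i) => //; exact: mem_basepointsl.
  - by have [i bi] := dq b c0; exists i.+1, (q i) => //; exact: mem_basepointsr.
have [z zP] : exists z, forall a, a \in q 0%N :: basepoints e m -> mdist z a = g a.
  by apply: urysohn_realize => x y _ _; exact: gK.
have [k zk] := dq z c0.
have [n0 n0c] := half_exp_small c0.
pose n := (maxn n0 (maxn m k)).+1.
have n0n : (n0 <= n)%N by rewrite ltnW// ltnS leq_maxl.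
have kn : (k < n)%N by rewrite ltnS !leq_max leqnn !orbT.
have mn : (m < n)%N by rewrite ltnS !leq_max leqnn !orbT.
have nc : 2^-1 ^+ n < c :> R.
  apply: le_lt_trans n0c; rewrite -(subnKC n0n) exprD.
  by rewrite ler_piMr// exprn_ile1// invf_le1// ler1n.
have [j jN jP] := rich n k m kn mn.
have ka a : a \in q 0%N :: basepoints e m -> `|mdist (q k) a - g a| <= c.
  by move=> /zP <-; have := mdist_abs_sub (q k) z a; rewrite (metric_sym (q k) z); lra.
have shadow_g y : `|shadow e k m y - g y| <= 3 * c.
  rewrite ler_norml; apply/andP; split.
    have [a ma] := hull_mem (mdist (q k)) (q 0%N) (basepoints e m) y.
    rewrite -/(shadow e k m y) => ->.
    have := ka a ma; have := hull_lip f b0 B y a; rewrite -/(g y) -/(g a).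
    by rewrite (metric_sym y a) ler_norml => ? /andP[? ?]; lra.
  have [b Bb gy] := hull_mem f b0 B y; rewrite -/(g y) in gy.
  have [|a ma ba] := mP b; first by rewrite -cat_cons mem_cat Bb.
  have ma' : a \in q 0%N :: basepoints e m by rewrite inE ma orbT.
  have := hull_le (mdist (q k)) y ma'; rewrite -/(shadow e k m y).
  have := ka a ma'; have := hull_lip f b0 B a b; rewrite -/(g a) -/(g b).
  rewrite {2}/g (hull_eq fK Bb) (metric_sym a b).
  have := metric_triangle a b y; rewrite (metric_sym a b).
  by rewrite ler_norml => ? ? /andP[? ?]; lra.
have near_g a : a \in basepoints e n -> `|mdist (q j) a - g a| <= 4 * c.
  move=> /basepointsP[i iN ai].
  have [je jq] := jP i iN; have := shadow_g a.
  by case: ai => ->; [move: je|move: jq]; rewrite !ler_norml => /andP[? ?] /andP[? ?];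
    apply/andP; split; lra.
have support_mn a : a \in basepoints e m -> a \in basepoints e n.
  move=> /basepointsP[i im ai]; have iN := ltn_trans im mn.
  by case: ai => ->; [exact: mem_basepointsl|exact: mem_basepointsr].
have near_move x a (t : R) : `|mdist (q j) a - g a| <= t -> mdist x a < c ->
    `|mdist (q j) x - g x| <= t + 2 * c.
  move=> ja xa; have [gxa _] := gK x a I I; have [gax _] := gK a x I I.
  have := metric_triangle (q j) a x; have := metric_triangle (q j) x a.
  rewrite (metric_sym a x) in gax *; move: ja.
  by rewrite !ler_norml => /andP[? ?] ? ?; apply/andP; split; lra.
exists (q j) => x [ex|Fx]; last first.
  have [|a ma xa] := mP x; first by rewrite -cat_cons mem_cat Fx orbT.
  apply: le_trans (near_move x a _ (near_g a (support_mn a ma)) xa) _.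
  by rewrite /c; lra.
have [l xl] := closure_range ex c0.
suff jl : `|mdist (q j) (e l) - g (e l)| <= 6 * c.
  by apply: le_trans (near_move x _ _ jl xl) _; rewrite /c; lra.
rewrite ler_norml; apply/andP; split.
  have [i iN jil] := free n j (ltn0Sn _) jN l.
  have := near_g _ (mem_basepointsl e iN); have [+ _] := gK (e l) (e i) I I.
  by rewrite (metric_sym (e l)) ler_norml => ? /andP[? ?]; lra.
have [b Bb gl] := hull_mem f b0 B (e l); rewrite -/(g (e l)) in gl.
have [|a ma ba] := mP b; first by rewrite -cat_cons mem_cat Bb.
have := near_g a (support_mn a ma); have := metric_triangle (q j) a (e l).
have := metric_triangle a b (e l); have := hull_lip f b0 B a b.
rewrite -/(g a) -/(g b) {2}/g (hull_eq fK Bb) (metric_sym a b).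
by rewrite ler_norml => ? ? ? /andP[? ?]; lra.
Qed.

End generic_sequence.

Section measurable_generic_embedding.
Context d (W : measurableType d) {R : realType} {U : urysohnSpaceType R}.
Variable q : nat -> U.
Hypothesis dq : dense_seq q.
Variable x : nat -> W -> U.
Hypothesis mx : forall n, mpoint q (x n).

Let point (E : nat -> W -> U) (t : bool * nat) (w : W) : U :=
  if t.1 then E t.2 w else q t.2.

Let mpoint_point E t : (forall i, mpoint q (E i)) -> mpoint q (point E t).
Proof. 
case: t => -[] i mE; first exact: (mE i).
exact: (@mpoint_cst _ W _ _ q (q i)).
Qed.

Lemma mreal_shadow (E : nat -> W -> U) (y : W -> U) k m :
  (forall i, mpoint q (E i)) -> mpoint q y ->
  mreal (fun w => shadow q (E^~ w) k m (y w)).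
Proof.
move=> mE my.
pose s := [seq (true, i) | i <- iota 0 m] ++ [seq (false, i) | i <- iota 0 m].
have sE w : basepoints q (E^~ w) m = [seq point E t w | t <- s].
  by rewrite map_cat -!map_comp.
have -> : (fun w => shadow q (E^~ w) k m (y w)) = (fun w => listmin
    (fun t => mdist (point E t w) (q k) + mdist (point E t w) (y w)) (false, 0%N) s).
  apply/funext => w; rewrite /shadow /hull sE.
  rewrite (@listmin_map _ _ _ _ (point E^~ w) (false, 0%N)).
  by apply: eq_listmin => t _ /=; rewrite (metric_sym (q k)).
apply: (@mreal_listmin _ _ _ _ (fun t w =>
  mdist (point E t w) (q k) + mdist (point E t w) (y w))) => t.
have mp := @mpoint_point E t mE.
by apply: mreal_add; [exact: mp|exact: (@mreal_dist _ W R U q dq (point E t) y mp my)].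
Qed.

(** The conditions of [independent_growth] on the point and the number chosen at
    index [n], given the earlier choices [f]. *)
Let stage n (f : nat -> (W -> U) * (W -> nat)) (a : (W -> U) * (W -> nat)) :=
  forall w, let e i := (f i).1 w in
  [/\ forall i, (i < n)%N -> mdist (a.1 w) (e i) = mdist (x n w) (x i w),
    (n <= a.2 w)%N, forall i, (i < n)%N -> ((f i).2 w <= a.2 w)%N,
    forall j, (0 < n)%N -> (j < a.2 w)%N ->
      exists2 i, (i < n)%N & mdist (q j) (e i) + mdist (e i) (a.1 w) <=
                             mdist (q j) (a.1 w) &
    forall k m, (k < n)%N -> (m < n)%N -> exists2 j, (j < a.2 w)%N &
      forall i, (i < n)%N ->
        `|mdist (q j) (e i) - shadow q e k m (e i)| <= 2^-1 ^+ n /\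
        `|mdist (q j) (q i) - shadow q e k m (q i)| <= 2^-1 ^+ n].

Let stage_ext n f g a :
  (forall i, (i < n)%N -> f i = g i) -> stage n f a -> stage n g a.
Proof.
move=> fg fa w; have [h1 h2 h3 h4 h5] := fa w.
have sE m : (m < n)%N -> basepoints q (fun i => (g i).1 w) m =
    basepoints q (fun i => (f i).1 w) m.
  move=> mn; congr cat; apply/eq_in_map => i; rewrite mem_iota => /andP[_ im].
  by rewrite fg// (ltn_trans _ mn).
split=> //.
- by move=> i iN; rewrite -fg//; exact: h1.
- by move=> i iN; rewrite -fg//; exact: h3.
- by move=> j n0 /(h4 j n0)[i iN]; exists i; rewrite // -fg.
- move=> k m kn mn; have [j jN jP] := h5 k m kn mn; exists j => // i iN.
  by rewrite /shadow sE// -fg//; exact: jP.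
Qed.

(** Every finitely supported function on a finite set is nearly the distance to
    some point of [q], so that finitely many points of [q] suffice for the
    finitely many conditions of a stage. *)
Let stage_index n (f : nat -> (W -> U) * (W -> nat)) :
  (forall i, mpoint q (f i).1 /\ mindex (f i).2) ->
  exists2 N, mindex N & forall w, let e i := (f i).1 w in
    [/\ (n <= N w)%N, forall i, (i < n)%N -> ((f i).2 w <= N w)%N &
     forall k m, (k < n)%N -> (m < n)%N -> exists2 j, (j < N w)%N &
      forall i, (i < n)%N ->
        `|mdist (q j) (e i) - shadow q e k m (e i)| <= 2^-1 ^+ n /\
        `|mdist (q j) (q i) - shadow q e k m (q i)| <= 2^-1 ^+ n].
Proof.
move=> mf; have mE i : mpoint q (f i).1 by case: (mf i).
pose close k m j w := forall i, (i < n)%N ->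
  let e i := (f i).1 w in
  `|mdist (q j) (e i) - shadow q e k m (e i)| <= 2^-1 ^+ n /\
  `|mdist (q j) (q i) - shadow q e k m (q i)| <= 2^-1 ^+ n.
pose P N w := [/\ (n <= N)%N, forall i, (i < n)%N -> ((f i).2 w <= N)%N &
  forall k m, (k < n)%N -> (m < n)%N -> exists j, (j < N)%N /\ close k m j w].
have [||N mN NP] := @least_index _ W P.
- move=> w; pose e i := (f i).1 w.
  have [N1 N1P] : exists N, forall i, i \in iota 0 n -> ((f i).2 w <= N)%N.
    apply: uniform_bound => [i a b ab /leq_trans|i _]; first exact.
    by exists ((f i).2 w).
  have [N2 N2P] : exists N, forall km, km \in [seq (k, m) | k <- iota 0 n, m <- iota 0 n] ->
      exists j, (j < N)%N /\ close km.1 km.2 j w.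
    apply: uniform_bound => [km a b ab [j [ja cj]]|[k m] _].
      by exists j; rewrite (leq_trans ja ab).
    have [z zP] := @urysohn_realize R U (basepoints q e n) (shadow q e k m)
      (fun y y' _ _ => hull_katetov (@katetov_mdist _ _ _ (q k)) I I).
    have [j zj] := dq z (half_exp_gt0 R n).
    exists j.+1, j; split=> // i iN /=.
    have near_z y : y \in basepoints q e n ->
        `|mdist (q j) y - shadow q e k m y| <= 2^-1 ^+ n.
      move=> /zP <-; have := mdist_abs_sub (q j) z y.
      by rewrite (metric_sym (q j) z); lra.
    by split; apply: near_z; [exact: mem_basepointsl|exact: mem_basepointsr].
  exists (maxn n (maxn N1 N2)); split=> [|i iN|k m kn mn].
  + exact: leq_maxl.
  + by rewrite !leq_max N1P ?orbT// mem_iota.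
  + have [|j [jN cj]] := N2P (k, m).
      by apply/allpairsP; exists (k, m); rewrite !mem_iota.
    by exists j; rewrite !leq_max jN !orbT.
- move=> N; apply: (@mprop_eq _ _ _ (fun w => (n <= N)%N /\
    ((forall i, (i < n)%N -> ((f i).2 w <= N)%N) /\
     forall k m, (k < n)%N -> (m < n)%N -> exists j, (j < N)%N /\ close k m j w))).
    by move=> w; split=> [[? ? ?]|[? []]].
  apply: mprop_and; first exact: mprop_cst.
  apply: mprop_and.
    apply: mprop_all => i; apply: mprop_if => _.
    apply: (@mprop_index _ W (f i).2 (fun k _ => (k <= N)%N)).
      by case: (mf i).
    by move=> k; exact: mprop_cst.
  apply: mprop_all => k; apply: mprop_all => m; apply: mprop_if => _.
  apply: mprop_if => _; apply: mprop_ex => j.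
  apply: mprop_and; first exact: mprop_cst.
  apply: mprop_all => i; apply: mprop_if => _; apply: mprop_and.
    apply: mprop_le; last exact: mreal_cst.
    apply/mreal_abs/mreal_sub; last exact: mreal_shadow.
    by under eq_fun do rewrite metric_sym; exact: (mE i).
  apply: mprop_le; last exact: mreal_cst.
  apply/mreal_abs/mreal_sub; first exact: mreal_cst.
  exact: (@mreal_shadow (fun i => (f i).1) (fun=> q i)) (@mpoint_cst _ W _ _ q (q i)).
exists N => // w; have [h1 h2 h3] := NP w; split=> // k m kn mn.
by have [j [jN cj]] := h3 k m kn mn; exists j.
Qed.

(** The point to choose realizes a Katetov function [g w] on the finite set of the
    previous points and of the first points of [q]; a ball around [q k] contains
    such a point as soon as the function extends to [q k] with a value at most
    the radius. *)
Let stage_point n (E : nat -> W -> U) (N : W -> nat) : (0 < n)%N ->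
  (forall i, mpoint q (E i)) -> mindex N ->
  (forall w i j, (i < n)%N -> (j < n)%N ->
    mdist (E i w) (E j w) = mdist (x i w) (x j w)) ->
  exists2 e, mpoint q e & forall w,
    (forall i, (i < n)%N -> mdist (e w) (E i w) = mdist (x n w) (x i w)) /\
    forall j, (j < N w)%N -> exists2 i, (i < n)%N &
      mdist (q j) (E i w) + mdist (E i w) (e w) <= mdist (q j) (e w).
Proof.
move=> n0 mE mN Ex.
pose g w u := listmin (fun i => mdist (x n w) (x i w) + mdist (E i w) u)
  0%N (iota 0 n).
pose active (t : bool * nat) w := if t.1 then (t.2 < n)%N : Prop else (t.2 < N w)%N.
pose C w := [set u | forall t, active t w ->
  mdist u (point E t w) = g w (point E t w)].
pose hit k r w := forall t, active t w ->
  `|mdist (q k) (point E t w) - g w (point E t w)| <= 2^-1 ^+ r.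
have index_lt i : (i \in 0%N :: iota 0 n) = (i < n)%N.
  by rewrite inE mem_iota /=; case: i.
have gP w : katetov setT (g w) /\
    forall i, (i < n)%N -> g w (E i w) = mdist (x n w) (x i w).
  have [p pP] := finite_isometric_image (x n w) (Ex w).
  have -> : g w = hull (mdist p) (E 0%N w) [seq E i w | i <- iota 0 n].
    apply/funext => u; rewrite /g /hull (@listmin_map _ _ _ _ (E^~ w)).
    by apply: eq_listmin => i; rewrite index_lt /= => /pP ->.
  split=> [|i iN]; first exact/hull_katetov/katetov_mdist.
  rewrite hull_eq ?pP//; first exact: katetov_mdist.
  by rewrite inE map_f ?orbT// mem_iota.
pose T w := [set point E t w | t in active^~ w].
have T0 w : T w !=set0 by exists (E 0%N w), (true, 0%N).
have Tlist w : [set` [seq E i w | i <- iota 0 n] ++ [seq q i | i <- iota 0 (N w)]]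
    = T w.
  apply/seteqP; split=> u /=.
    rewrite mem_cat => /orP[] /mapP[i]; rewrite mem_iota => iN ->.
      by exists (true, i).
    by exists (false, i).
  move=> [[[] i] /= iN <-]; rewrite mem_cat /point /=.
    by rewrite map_f// mem_iota.
  by rewrite orbC map_f// mem_iota.
have [||||||e me eC] := @measurable_selection _ W R U q dq C hit.
- exact: urysohn_complete.
- by move=> w; exact: closed_equidistant.
- move=> w; have := @urysohn_realize R U
    ([seq E i w | i <- iota 0 n] ++ [seq q i | i <- iota 0 (N w)]) (g w).
  move=> [|u uP]; first by move=> y z _ _; exact: (gP w).1.
  exists u => t tw; apply: uP.
  have : T w (point E t w) by exists t.
  by rewrite -Tlist.
- move=> k r; apply: mprop_all => t; apply: mprop_imp.
    case: t => -[] i; first exact: mprop_cst.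
    apply: (@mprop_index _ W N (fun k _ => (i < k)%N)) => // j.
    exact: mprop_cst.
  have mp := mpoint_point t mE.
  apply: mprop_le; last exact: mreal_cst.
  apply/mreal_abs/mreal_sub.
    by under eq_fun do rewrite metric_sym; exact: mp.
  apply: (@mreal_listmin _ _ _ _ (fun i w =>
    mdist (x n w) (x i w) + mdist (E i w) (point E t w))) => i.
  by apply: mreal_add; apply: (mreal_dist dq).
- move=> w k r u Cu uk t tw; rewrite -(Cu t tw).
  by have := mdist_abs_sub (q k) u (point E t w); rewrite (metric_sym _ u); lra.
- move=> w k r hk.
  have [||f [fK fg fk]] := @katetov_extend R U (T w) (g w) (q k) (2^-1 ^+ r) (T0 w).
  + by move=> y z _ _; exact: (gP w).1.
  + by move=> _ [t tw <-]; exact: hk.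
  have [|u uP] := @urysohn_realize R U (q k ::
      ([seq E i w | i <- iota 0 n] ++ [seq q i | i <- iota 0 (N w)])) f.
    by rewrite set_mem_cons Tlist.
  exists u => [t tw|]; last by rewrite uP ?mem_head.
  have Tt : T w (point E t w) by exists t.
  rewrite -fg// uP// inE; move: Tt; rewrite -Tlist => Tt.
  by apply/orP; right.
exists e => // w; have ex i : (i < n)%N -> mdist (e w) (E i w) = mdist (x n w) (x i w).
  by move=> iN; have := eC w (true, i) iN; rewrite /point /= (gP w).2.
split=> // j jN; have := eC w (false, j) jN; rewrite /point /=.
have [i] := listmin_mem (fun i => mdist (x n w) (x i w) + mdist (E i w) (q j))
  0%N (iota 0 n); rewrite -/(g w (q j)) index_lt => iN -> ej; exists i => //.
rewrite (metric_sym (q j) (e w)) ej -ex// (metric_sym (q j)) (metric_sym (e w)).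
by rewrite addrC.
Qed.

(** Every stage has a measurable solution: first the number of points of [q] to
    take care of, then the point itself. *)
Lemma measurable_generic_embedding : exists e : nat -> W -> U,
  [/\ forall n, mpoint q (e n),
    forall w n m, mdist (e n w) (e m w) = mdist (x n w) (x m w) &
    forall w, generic (closure (range (e^~ w)))].
Proof.
pose Inv (a : (W -> U) * (W -> nat)) := mpoint q a.1 /\ mindex a.2.
have [|||f fP] := @history_choice _ (fun=> q 0%N, fun=> 0%N) Inv stage.
- split; first exact: (@mpoint_cst _ W _ _ q (q 0%N)).
  by move=> k; exact: (mprop_cst W (0%N = k)).
- exact: stage_ext.
- move=> n f If fP; have [N mN NP] := stage_index n If.
  have fx w i j : (i < n)%N -> (j < n)%N ->
      mdist ((f i).1 w) ((f j).1 w) = mdist (x i w) (x j w).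
    wlog ij : i j / (i <= j)%N => [hw iN jn|iN jn].
      have [ij|/ltnW ji] := leqP i j; first exact: hw.
      by rewrite metric_sym [RHS]metric_sym; exact: hw.
    move: ij; rewrite leq_eqVlt => /predU1P[->|ij]; first by rewrite !mdistxx.
    have [fj _ _ _ _] := fP j jn w.
    by rewrite metric_sym [RHS]metric_sym; exact: fj.
  have [n0|n0] := posnP n; last first.
    have [e me eP] := @stage_point n (fun i => (f i).1) N n0
      (fun i => (If i).1) mN fx.
    exists (e, N) => // w; have [e1 e2] := eP w; have [N1 N2 N3] := NP w.
    by split=> // j _ /e2.
  exists (x n, N); first by split; [exact: mx|].
  by move=> w; have [N1 N2 N3] := NP w; split=> //; rewrite n0.
exists (fun n => (f n).1); split.
- by move=> n; have [[]] := fP n.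
- move=> w n m; wlog nm : n m / (m <= n)%N => [hw|].
    have [|/ltnW] := leqP m n; first exact: hw.
    by rewrite metric_sym [RHS]metric_sym; exact: hw.
  move: nm; rewrite leq_eqVlt => /predU1P[->|nm]; first by rewrite !mdistxx.
  by have [_ /(_ w)[+ _ _ _ _]] := fP n; apply.
- move=> w; apply: (@independent_growth_generic R U q dq _ (fun n => (f n).2 w)).
  split.
  + by move=> n; have [_ /(_ w)[]] := fP n.
  + move=> i n; rewrite leq_eqVlt => /predU1P[->//|iN].
    by have [_ /(_ w)[_ _ + _ _]] := fP n; apply.
  + by move=> n j n0 jn; have [_ /(_ w)[_ _ _ + _]] := fP n; apply.
  + by move=> n; have [_ /(_ w)[_ _ _ _]] := fP n.
Qed.

End measurable_generic_embedding.

(** * Borel structure of the space of structures *)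

Section pointwise_topology.
Context {R : realType} {I : eqType} {X : metricType R}.
Implicit Types (f : {ptws I -> X}) (s : seq I).

Definition ptws_box s (r : R) f : set {ptws I -> X} :=
  [set g | forall i, i \in s -> mdist (f i) (g i) < r].

Lemma open_ptws_box s (a : I -> X) (r : R) :
  open [set g : {ptws I -> X} | forall i, i \in s -> mdist (a i) (g i) < r].
Proof.
elim: s => [|i s IH].
  by rewrite (_ : mkset _ = setT); [exact: openT|apply/seteqP; split].
have ai : open [set g : {ptws I -> X} | mdist (a i) (g i) < r].
  apply: (@open_comp {ptws I -> X} X (fun g => g i) [set y | mdist (a i) y < r]).
    by move=> f _; exact: (@proj_continuous I (fun=> X) i f).
  exact: open_mball.
have -> : [set g : {ptws I -> X} |
      forall j, j \in i :: s -> mdist (a j) (g j) < r] =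
    [set g : {ptws I -> X} | mdist (a i) (g i) < r] `&`
    [set g : {ptws I -> X} | forall j, j \in s -> mdist (a j) (g j) < r].
  apply/seteqP; split=> [g gs|g [gi gs] j].
    split=> [|j sj]; first exact: gs (mem_head _ _).
    by apply: gs; rewrite inE sj orbT.
  by rewrite inE => /predU1P[->|/gs].
exact: openI.
Qed.

Lemma nbhs_ptws_box s (r : R) f : 0 < r -> nbhs f (ptws_box s r f).
Proof.
move=> r0; apply: open_nbhs_nbhs; split; first exact: open_ptws_box.
by move=> i _; rewrite mdistxx.
Qed.

Lemma nbhs_ptwsP f (A : set {ptws I -> X}) :
  nbhs f A <-> exists s, exists2 r : R, 0 < r & ptws_box s r f `<=` A.
Proof.
split=> [fA|[s [r r0 sA]]]; last first.
  have FN : Filter (nbhs f) := nbhs_filter f.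
  by apply: filterS sA _; exact: nbhs_ptws_box.
pose F : set_system {ptws I -> X} :=
  [set B | exists s, exists2 r : R, 0 < r & ptws_box s r f `<=` B].
have FF : Filter F.
  split=> [|B C [s [r r0 sB]] [t [r' r'0 tC]]|B C BC [s [r r0 sB]]].
  - by exists [::], 1.
  - exists (s ++ t), (Num.min r r'); first by rewrite lt_min r0.
    move=> g gst; split; [apply: sB|apply: tC] => i iS;
      have := gst i; rewrite mem_cat iS ?orbT lt_min => /(_ isT)/andP[]//.
  - by exists s, r => //; exact: subset_trans BC.
suff : F --> f by apply.
apply/cvg_sup => i B [_ [[C oC <-] Cfi] CB].
have : nbhs (f i) C by exact: open_nbhs_nbhs.
rewrite -nbhs_ballE => -[r /= r0 fC].
exists [:: i], r => // g gi; apply/CB/fC; rewrite ballEmdist /=.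
by apply: gi; rewrite mem_seq1.
Qed.

End pointwise_topology.

Section structure_measurability.
Context {R : realType} {U : urysohnSpaceType R} {L : signature}.
Local Notation M := (structure_space U L).

Lemma mprop_dom_hits (O : set U) : open O ->
  @mprop _ M (fun X => struct_dom X `&` O !=set0).
Proof.
move=> oO; exists (fst @^-1` [set C : effros U | (C : closed_set U) `&` O !=set0]).
  rewrite -[X in measurable X]setTI; apply: measurable_fst => //.
  by apply: sub_sigma_algebra; exists O.
by rewrite setTI.
Qed.

Lemma mprop_rel_hits (n : L) (O : set {ptws 'I_(arity n) -> U}) : open O ->
  @mprop _ M (fun X => struct_rel X n `&` O !=set0).
Proof.
move=> oO; pose H := [set C : effros {ptws 'I_(arity n) -> U} |
  (C : closed_set _) `&` O !=set0].
pose P := prod_measurable (fun n : L => effros {ptws 'I_(arity n) -> U}).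
exists (snd @^-1` [set C : P | H (C n)]).
  rewrite -[X in measurable X]setTI; apply: measurable_snd => //.
  apply: sub_sigma_algebra; exists n => //; exists H; last by rewrite setTI.
  by apply: sub_sigma_algebra; exists O.
by rewrite setTI.
Qed.

Lemma measurable_to_effros d (W : measurableType d) (Z : topologicalType)
    (f : W -> effros Z) :
  (forall O, open O -> mprop (fun w => (f w : closed_set Z) `&` O !=set0)) ->
  measurable_fun setT f.
Proof.
move=> mf; apply: measurability; first by [].
by move=> _ [_ [V oV <-] <-]; rewrite setTI; exact: mf.
Qed.

Lemma measurable_to_structure d (W : measurableType d) (f : W -> M) :
  (forall O, open O -> mprop (fun w => struct_dom (f w) `&` O !=set0)) ->
  (forall (n : L) (O : set {ptws 'I_(arity n) -> U}), open O ->
    mprop (fun w => struct_rel (f w) n `&` O !=set0)) ->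
  measurable_fun setT f.
Proof.
move=> mdom mrel.
suff mf : measurable_fun setT (\val \o f : W -> pre_structure U L).
  move=> _ _ [B mB <-]; rewrite setTI.
  by have := mf measurableT B mB.
apply/measurable_fun_pairP; split.
  exact: (@measurable_to_effros _ W U (fun w => (\val (f w)).1) mdom).
apply: measurability => //.
move=> _ [_ [n _ [B mB <-]] <-]; rewrite !setTI.
suff mn : measurable_fun setT (fun w => (\val (f w)).2 n :
    effros {ptws 'I_(arity n) -> U}).
  by have := mn measurableT B mB; rewrite setTI.
by apply: measurable_to_effros => O; exact: mrel.
Qed.

End structure_measurability.

Section dense_selection.
Context {R : realType} {U : urysohnSpaceType R} {L : signature}.
Local Notation M := (structure_space U L).
Variable q : nat -> U.
Hypothesis dq : dense_seq q.

(** One point is selected near each point of [q] that is close to the domain. *)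
Lemma measurable_dense_seq : exists x : nat -> M -> U,
  [/\ forall n, mpoint q (x n), forall n X, struct_dom X (x n X) &
    forall X y (r : R), struct_dom X y -> 0 < r ->
      exists n, mdist y (x n X) < r].
Proof.
pose near k m : set U := [set y | mdist (q k) y < 2^-1 ^+ m].
pose A k m (X : M) := struct_dom X `&` near k m.
pose B k m (X : M) := if pselect (A k m X !=set0) then A k m X else struct_dom X.
have BX k m X : B k m X `<=` struct_dom X.
  by rewrite /B; case: pselect => h //=; exact: subIsetl.
have BT k m X : A k m X !=set0 -> B k m X = A k m X.
  by rewrite /B; case: pselect.
have BF k m X : ~ (A k m X !=set0) -> B k m X = struct_dom X.
  by rewrite /B; case: pselect.
have /choice[x xP] (km : nat * nat) : exists e : M -> U, mpoint q e /\
    forall X, closure (B km.1 km.2 X) (e X).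
  case: km => k m /=.
  have [||||||e me eP] := @measurable_selection _ M R U q dq
    (fun X => closure (B k m X)) (fun j n X => B k m X `&` near j n !=set0).
  - exact: urysohn_complete.
  - by move=> X; exact: closed_closure.
  - move=> X; have [y By] : B k m X !=set0.
      have [h|h] := pselect (A k m X !=set0); first by rewrite BT.
      by rewrite BF//; exact: struct_dom_neq0.
    by exists y; exact: subset_closure.
  - move=> j n; apply: (@mprop_eq _ _ _ (fun X =>
      (A k m X !=set0 -> struct_dom X `&` (near k m `&` near j n) !=set0) /\
      (~ (A k m X !=set0) -> struct_dom X `&` near j n !=set0))).
      move=> X; rewrite setIA; have [h|h] := pselect (A k m X !=set0).
        by rewrite BT//; split=> [?|[+ _]]; [split|apply].
      by rewrite BF//; split=> [?|[_]]; [split|apply].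
    have oA := @mprop_dom_hits R U L _ (@open_mball _ _ (q k) (2^-1 ^+ m)).
    apply: mprop_and; apply: mprop_imp => //.
    + by apply: mprop_dom_hits; apply: openI; exact: open_mball.
    + exact: mprop_not.
    + by apply: mprop_dom_hits; exact: open_mball.
  - move=> X j n u Bu uj.
    have [|y By uy] := closure_mdist (r := 2^-1 ^+ n - mdist u (q j)) _ Bu.
      by rewrite subr_gt0.
    exists y; split => //; rewrite /near /= metric_sym.
    have := metric_triangle y u (q j); rewrite (metric_sym y u); lra.
  - move=> X j n [u [Bu /ltW uj]]; exists u; first exact: subset_closure.
    by rewrite metric_sym.
  by exists e.
exists (fun n => x (odflt (0, 0)%N (unpickle n))); split.
- by move=> n; have [] := xP (odflt (0, 0)%N (unpickle n)).
- move=> n X; apply: struct_dom_closed.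
  exact: (closure_subset (@BX _ _ X)) _ ((xP _).2 X).
- move=> X y r Xy r0; have [|m mr] := @half_exp_small R (r / 3); first by lra.
  have [k yk] := dq y (half_exp_gt0 R m).
  exists (pickle (k, m)); rewrite pickleK /=.
  have Ay : A k m X y by split; rewrite // /near /= metric_sym.
  have := (xP (k, m)).2 X; rewrite BT; last by exists y.
  have h0 := half_exp_gt0 R m.
  move=> /(closure_mdist h0)[z [_ kz] xz].
  have := metric_triangle y (q k) z; have := metric_triangle y z (x (k, m) X).
  by rewrite (metric_sym z); move: kz; rewrite /near /=; lra.
Qed.

End dense_selection.

(** * Isomorphisms as graphs *)

Section structure_graph.
Context {R : realType} {U : urysohnSpaceType R} {L : signature}.
Local Notation M := (structure_space U L).
Implicit Types (X Y Z : M) (G H : set (U * U)).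

(** Isomorphisms between the structures carried by closed subsets of [U], as
    graphs: in this form they are composed, inverted and extended inside [U]. *)
Definition structure_graph X Y G :=
  [/\ isometric_graph G, fst @` G = struct_dom X, snd @` G = struct_dom Y &
    forall (n : L) (x y : {ptws 'I_(arity n) -> U}),
      (forall i, G (x i, y i)) -> (struct_rel X n x <-> struct_rel Y n y)].

Lemma structure_ext X Y : struct_dom X = struct_dom Y ->
  (forall n, struct_rel X n = struct_rel Y n) -> X = Y.
Proof.
rewrite /struct_dom /struct_rel => XY1 XY2; apply: val_inj.
case: (\val X) (\val Y) XY1 XY2 => X1 X2 [Y1 Y2]; rewrite /pre_dom /pre_rel /=.
move=> XY1 XY2; congr pair; first exact: closed_set_inj.
by apply: functional_extensionality_dep => n; exact/closed_set_inj/XY2.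
Qed.

Lemma isometric_graph_inj G x y y' :
  isometric_graph G -> G (x, y) -> G (x, y') -> y = y'.
Proof.
move=> Gi Gxy Gxy'; apply: mdist_positivity.
by rewrite -(Gi _ _ Gxy Gxy') mdistxx.
Qed.

Lemma isometric_graph_injr G x x' y :
  isometric_graph G -> G (x, y) -> G (x', y) -> x = x'.
Proof.
move=> Gi Gxy Gx'y; apply: mdist_positivity.
by rewrite (Gi _ _ Gxy Gx'y) mdistxx.
Qed.

Lemma structure_graph_domE X Y G x : structure_graph X Y G ->
  struct_dom X x -> exists y, G (x, y).
Proof. by move=> [_ <- _ _] [[a b] Gab /= <-]; exists b. Qed.

Lemma structure_graph_codE X Y G y : structure_graph X Y G ->
  struct_dom Y y -> exists x, G (x, y).
Proof. by move=> [_ _ <- _] [[a b] Gab /= <-]; exists a. Qed.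

Lemma structure_graph_dom X Y G x y : structure_graph X Y G -> G (x, y) ->
  struct_dom X x /\ struct_dom Y y.
Proof. by move=> [_ <- <- _] Gxy; split; exists (x, y). Qed.

Lemma structure_graph_inv X Y G :
  structure_graph X Y G -> structure_graph Y X (graph_inv G).
Proof.
move=> XYG; have [Gi GX GY Grel] := XYG; split.
- by move=> p r Gp Gr; rewrite (Gi _ _ Gp Gr).
- rewrite -GY; apply/seteqP; split=> _ [[a b] Gab /= <-]; exists (b, a) => //.
- rewrite -GX; apply/seteqP; split=> _ [[a b] Gab /= <-]; exists (b, a) => //.
- by move=> n x y Gxy; rewrite (Grel n y x).
Qed.

Lemma structure_graph_comp X Y Z G H :
  structure_graph X Y G -> structure_graph Y Z H ->
  structure_graph X Z [set p | exists2 y, G (p.1, y) & H (y, p.2)].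
Proof.
move=> XYG YZH; have [Gi GX GY Grel] := XYG; have [Hi HY HZ Hrel] := YZH; split.
- move=> [x z] [x' z'] [y Gxy Hyz] [y' Gxy' Hyz'] /=.
  by rewrite -(Hi _ _ Hyz Hyz') (Gi _ _ Gxy Gxy').
- apply/seteqP; split=> [_ [[x z] /= [y Gxy _] <-]|x Xx].
    by have [] := structure_graph_dom XYG Gxy.
  have [y Gxy] := structure_graph_domE XYG Xx.
  have [_ Yy] := structure_graph_dom XYG Gxy.
  have [z Hyz] := structure_graph_domE YZH Yy.
  by exists (x, z) => //; exists y.
- apply/seteqP; split=> [_ [[x z] /= [y _ Hyz] <-]|z Zz].
    by have [] := structure_graph_dom YZH Hyz.
  have [y Hyz] := structure_graph_codE YZH Zz.
  have [Yy _] := structure_graph_dom YZH Hyz.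
  have [x Gxy] := structure_graph_codE XYG Yy.
  by exists (x, z) => //; exists y.
- move=> n x z xz.
  have /choice[y yP] i : exists y, G (x i, y) /\ H (y, z i).
    by have [y ? ?] := xz i; exists y.
  rewrite (Grel n x y) ?(Hrel n y z)// => i; by have [] := yP i.
Qed.

Lemma structure_isoP X Y : structure_iso X Y <-> exists G, structure_graph X Y G.
Proof.
split=> [[h [[g hK gK] hi hrel]]|[G XYG]].
  exists [set p | exists a : set_type (struct_dom X), p = (\val a, \val (h a))].
  split.
  - by move=> _ _ [a ->] [b ->]; have := hi a b; rewrite /mdist/=.
  - apply/seteqP; split=> [_ [_ [a ->] <-] /=|x Xx]; first exact: set_valP.
    pose a : set_type (struct_dom X) := exist _ x (mem_set Xx).
    by exists (x, \val (h a)) => //; exists a.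
  - apply/seteqP; split=> [_ [_ [a ->] <-] /=|y Yy]; first exact: set_valP.
    pose b : set_type (struct_dom Y) := exist _ y (mem_set Yy).
    by exists (\val (g b), y) => //; exists (g b); rewrite gK.
  - move=> n x y xy.
    have /choice[a aP] i : exists a : set_type (struct_dom X),
      (x i, y i) = (\val a, \val (h a)) by have [a] := xy i; exists a.
    have -> : x = (fun i => \val (a i)) by apply/funext => i; have [] := aP i.
    have -> : y = (fun i => \val (h (a i))) by apply/funext => i; have [] := aP i.
    exact: (hrel n a).
have [Gi GX GY Grel] := XYG.
have /choice[h hP] (a : set_type (struct_dom X)) :
    exists b : set_type (struct_dom Y), G (\val a, \val b).
  have [y Gy] := structure_graph_domE XYG (set_valP a).
  have [_ Yy] := structure_graph_dom XYG Gy.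
  by exists (exist _ y (mem_set Yy)).
have /choice[g gP] (b : set_type (struct_dom Y)) :
    exists a : set_type (struct_dom X), G (\val a, \val b).
  have [x Gx] := structure_graph_codE XYG (set_valP b).
  have [Xx _] := structure_graph_dom XYG Gx.
  by exists (exist _ x (mem_set Xx)).
exists h; split.
- exists g => [a|b]; apply: val_inj.
    exact: isometric_graph_injr Gi (gP (h a)) (hP a).
  exact: isometric_graph_inj Gi (hP (g b)) (gP b).
- by move=> a b; exact: esym (Gi _ _ (hP a) (hP b)).
- move=> n a; exact: (Grel n (fun i => \val (a i)) (fun i => \val (h (a i)))).
Qed.

Lemma structure_graph_act X (s : iso U) :
  structure_graph X (structure_act s X) [set p | struct_dom X p.1 /\ p.2 = s p.1].
Proof.
split.
- by move=> p r [_ ->] [_ ->]; rewrite iso_isometric.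
- apply/seteqP; split=> [_ [p [Xp _] <-]//|x Xx].
  by exists (x, s x).
- apply/seteqP; split=> [_ [p [Xp pE] <-]|_ [x Xx <-]].
    by rewrite pE; exists p.1.
  by exists (x, s x).
- move=> n x y xy.
  have -> : y = s \o x by apply/funext => i; have [] := xy i.
  split=> [Xx|[x' Xx' sx]]; first by exists x.
  suff -> : x = x' by [].
  apply/funext => i; rewrite -(isoK s (x i)) -(isoK s (x' i)).
  by congr (iso_inv s _); exact/esym/(congr1 (fun f => f i) sx).
Qed.

Lemma structure_graph_actE X Y G (s : iso U) : structure_graph X Y G ->
  (forall p, G p -> s p.1 = p.2) -> structure_act s X = Y.
Proof.
move=> XYG sG; have [Gi GX GY Grel] := XYG; apply: structure_ext.
  apply/seteqP; split=> [_ [x Xx <-]|y Yy].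
    have [y Gxy] := structure_graph_domE XYG Xx.
    rewrite [s x](sG (x, y))//.
    by have [] := structure_graph_dom XYG Gxy.
  have [x Gxy] := structure_graph_codE XYG Yy.
  exists x; last exact: (sG (x, y)).
  by have [] := structure_graph_dom XYG Gxy.
move=> n; apply/seteqP; split=> [_ [x Xx <-]|y Yy].
  apply/(Grel n x _) => // i.
  have [y Gxy] := structure_graph_domE XYG (struct_rel_sub Xx i).
  by rewrite /= [s (x i)](sG (x i, y)).
have /choice[x xP] i : exists x, G (x, y i).
  exact: structure_graph_codE XYG (struct_rel_sub Yy i).
exists x; first exact/(Grel n x y).
by apply/funext => i /=; exact: (sG (x i, y i)).
Qed.

(** For domains in general position, isomorphisms extend to [U]. *)
Lemma generic_structure_iso X Y : generic (struct_dom X) ->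
  generic (struct_dom Y) ->
  structure_iso X Y <-> orbit_equivalence (@structure_act R U L) X Y.
Proof.
move=> Xgen Ygen; rewrite structure_isoP; split=> [[G XYG]|[s <-]]; last first.
  by eexists; exact: structure_graph_act.
have [Gi GX GY _] := XYG.
have [s sG] := generic_extends Xgen Ygen (struct_dom_neq0 X) (struct_dom_neq0 Y)
  Gi GX GY.
by exists s; exact: structure_graph_actE XYG sG.
Qed.

End structure_graph.

(** * Transport of a structure along an isometry *)

Section transport.
Context {R : realType} {U : urysohnSpaceType R} {L : signature}.
Local Notation M := (structure_space U L).
Variables (X : M) (x e : nat -> U).
Hypothesis Xx : forall n, struct_dom X (x n).
Hypothesis dx : forall y (r : R), struct_dom X y -> 0 < r ->
  exists n, mdist y (x n) < r.
Hypothesis ex : forall n m, mdist (e n) (e m) = mdist (x n) (x m).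

(** The graph of the isometry from the domain of [X] to [closure (range e)]
    that maps [x i] to [e i]. *)
Definition transport_graph : set (U * U) :=
  [set p | struct_dom X p.1 /\ forall i, mdist p.2 (e i) = mdist p.1 (x i)].

Lemma transport_isometric : isometric_graph transport_graph.
Proof.
move=> [a b] [a' b'] [/= Xa ab] [/= Xa' ab'].
apply/eqP; rewrite -subr_eq0 -normr_eq0 eq_le normr_ge0 andbT.
apply: le_of_approx => r r0; have [|i ai] := dx Xa (r := r / 2); first by lra.
have := mdist_abs_sub a (x i) a'; have := mdist_abs_sub b (e i) b'.
rewrite (metric_sym (e i)) ab' ab (metric_sym (x i) a') add0r.
by rewrite !ler_norml => /andP[? ?] /andP[? ?]; apply/andP; split; lra.
Qed.

Let pairs : set (U * U) := range (fun i => (x i, e i)).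

Let pairs_isometric : isometric_graph pairs.
Proof. by move=> _ _ [i _ <-] [j _ <-] /=; rewrite ex. Qed.

Lemma transport_dom : fst @` transport_graph = struct_dom X.
Proof.
apply/seteqP; split=> [_ [p [Xp _] <-]//|a Xa].
have [|b bP] := isometric_graph_image (x := a) pairs_isometric.
  by move=> r /(dx Xa)[i ai]; exists (x i, e i) => //; exists i.
by exists (a, b) => //; split=> // i; apply: (bP (x i, e i)); exists i.
Qed.

Lemma transport_cod : snd @` transport_graph = closure (range e).
Proof.
apply/seteqP; split=> [_ [[a b] [/= Xa ab] <-]|b eb].
  apply: closed_mdist; first exact: closed_closure.
  move=> r /(dx Xa)[i ai]; exists (e i); last by rewrite ab.
  by apply: subset_closure; exists i.
have [|r /(closure_range eb)[i bi]|a aP] :=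
  @isometric_graph_image _ _ (graph_inv pairs) b.
- by move=> p p' /pairs_isometric H /H ->.
- by exists (e i, x i) => //; exists i.
have ab i : mdist a (x i) = mdist b (e i) by apply: (aP (e i, x i)); exists i.
exists (a, b) => //; split=> //; apply: closed_mdist.
  exact: struct_dom_closed.
by move=> r /(closure_range eb)[i bi]; exists (x i) => //; rewrite ab.
Qed.

Definition transport_rel (n : L) : set {ptws 'I_(arity n) -> U} :=
  [set w | exists2 y, struct_rel X n y & forall i, transport_graph (y i, w i)].

Arguments transport_rel : clear implicits.

Lemma transport_rel_closed n : closed (transport_rel n).
Proof.
move=> w wC.
have near_w (r : R) : 0 < r -> exists2 w', transport_rel n w' &
    forall i, mdist (w i) (w' i) < r.
  move=> r0; have [w' [w'T ww']] := wC _ (nbhs_ptws_box (enum 'I_(arity n)) w r0).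
  by exists w' => // i; apply: ww'; rewrite mem_enum.
have /choice[y yP] i : exists y, transport_graph (y, w i).
  have : closure (range e) (w i).
    apply: closed_mdist; first exact: closed_closure.
    move=> r /near_w[w' [y _ yw'] ww']; exists (w' i) => //.
    by rewrite -transport_cod; exists (y i, w' i).
  by rewrite -transport_cod => -[[a b] ab /= <-]; exists a.
exists y; last exact: yP.
apply: (@struct_rel_closed _ _ _ X n) => A /nbhs_ptwsP[s [r r0 sA]].
 have [w' [y' Xy' yw'] ww'] := near_w r r0.
exists y'; split=> //; apply: sA => i _.
by have /= -> := transport_isometric (yP i) (yw' i); exact: ww'.
Qed.

Lemma transport_exists : exists Y : M, struct_dom Y = closure (range e) /\
  forall n, struct_rel Y n = transport_rel n.
Proof.
pose Y : pre_structure U L := (ClosedSet (@closed_closure _ (range e)),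
  fun n => ClosedSet (@transport_rel_closed n)).
suff YP : structure_set Y by exists (exist _ Y (mem_set YP)).
split; first by exists (e 0%N); apply: subset_closure; exists 0%N.
move=> n w [y _ yw] i; change (closure (range e) (w i)).
by rewrite -transport_cod; exists (y i, w i).
Qed.

Lemma transport_structure_graph Y : struct_dom Y = closure (range e) ->
  (forall n, struct_rel Y n = transport_rel n) ->
  structure_graph X Y transport_graph.
Proof.
move=> Y1 Y2; split.
- exact: transport_isometric.
- exact: transport_dom.
- by rewrite Y1; exact: transport_cod.
- move=> n y w yw; rewrite Y2; split=> [Xy|[y' Xy' y'w]]; first by exists y.
  suff -> : y = y' by [].
  by apply/funext => i; exact: isometric_graph_injr transport_isometric (yw i) (y'w i).
Qed.

End transport.
Arguments transport_rel {R U L} X x e n.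

(** * Reduction to the action of the isometry group *)

Section reduction.
Context {R : realType} {U : urysohnSpaceType R} {L : signature}.
Local Notation M := (structure_space U L).

(** A transported relation meets an open set [V] if and only if some box centered
    at points of [q] meets the relation, the points [x i] that are close to its
    center being moved to points [e i] that are close to the center of a box
    inside [V]; there are countably many choices of the indices. *)
Lemma measurable_transport (q : nat -> U) (x e : nat -> M -> U) (F : M -> M) :
  dense_seq q -> (forall n, mpoint q (x n)) -> (forall n, mpoint q (e n)) ->
  (forall n X, struct_dom X (x n X)) ->
  (forall X y (r : R), struct_dom X y -> 0 < r -> exists n, mdist y (x n X) < r) ->
  (forall X n m, mdist (e n X) (e m X) = mdist (x n X) (x m X)) ->
  (forall X, struct_dom (F X) = closure (range (e^~ X))) ->
  (forall X n, struct_rel (F X) n = transport_rel X (x^~ X) (e^~ X) n) ->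
  measurable_fun setT F.
Proof.
move=> dq mx me Xx dx ex Fdom Frel; apply: measurable_to_structure => [V oV|n V oV].
  apply: (@mprop_eq _ _ _ (fun X => exists i, V (e i X))).
    move=> X; rewrite Fdom; split=> [[y [ey Vy]]|[i Ve]]; last first.
      by exists (e i X); split=> //; apply: subset_closure; exists i.
    have [_ [[i _ <-]]] := ey V (open_nbhs_nbhs (conj oV Vy)).
    by exists i.
  by apply: mprop_ex => i; exact: (@mprop_open _ M R U q dq (e i) V (me i) oV).
pose l := arity n.
pose box (k : {ffun 'I_l -> nat}) (r : R) := [set w : {ptws 'I_l -> U} |
  forall i, i \in enum 'I_l -> mdist (q (k i)) (w i) < r].
apply: (@mprop_eq _ _ _ (fun X => exists i k j : {ffun 'I_l -> nat}, exists m,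
  (forall t, mdist (x (i t) X) (q (k t)) < 2^-1 ^+ m) /\
  (struct_rel X n `&` box k (2^-1 ^+ m) !=set0 /\
  ((forall t, mdist (e (i t) X) (q (j t)) < 2^-1 ^+ m) /\
    box j (3 * 2^-1 ^+ m) `<=` V)))); last first.
  apply: mprop_ex => i; apply: mprop_ex => k; apply: mprop_ex => j.
  apply: mprop_ex => m; apply: mprop_and.
    by apply: mprop_all => t; exact: mprop_lt (mx (i t) (k t)) (@mreal_cst _ M R (2^-1 ^+ m)).
  apply: mprop_and; first by apply: mprop_rel_hits; exact: open_ptws_box.
  apply: mprop_and; last exact: mprop_cst.
  by apply: mprop_all => t; exact: mprop_lt (me (i t) (j t)) (@mreal_cst _ M R (2^-1 ^+ m)).
move=> X; rewrite Frel.
split=> [[w [[y Xy yw] Vw]]|[i [k [j [m [xk [[y [Xy ky]] [ej jV]]]]]]]]; last first.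
  have /choice[w yw] t : exists b, transport_graph X (x^~ X) (e^~ X) (y t, b).
    have := struct_rel_sub Xy t.
    by rewrite -(transport_dom (dx X) (ex X)) => -[[a b] ab /= <-]; exists b.
  exists w; split; first by exists y.
  apply: jV => t _; have := ky t (mem_enum _ _); have := ej t; have := xk t.
  have [_ /(_ (i t)) /= wy] := yw t.
  have := metric_triangle (q (j t)) (e (i t) X) (w t).
  have := metric_triangle (x (i t) X) (q (k t)) (y t).
  rewrite (metric_sym (q (j t)) (e _ _)) (metric_sym (e _ _) (w t)) wy.
  by rewrite (metric_sym (x _ _) (y t)); lra.
have /nbhs_ptwsP[s [r r0 sV]] : nbhs (w : {ptws 'I_l -> U}) V.
  exact: open_nbhs_nbhs.
have [|m mr] := @half_exp_small R (r / 4); first by lra.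
have h0 := half_exp_gt0 R m.+1; have hS := half_expS R m.
have /choice[i ix] t : exists i, mdist (y t) (x i X) < 2^-1 ^+ m.+1.
  by apply: dx => //; exact: struct_rel_sub Xy t.
have /choice[k yk] t := dq (y t) _ h0.
have /choice[j wj] t := dq (w t) _ h0.
exists (finfun i), (finfun k), (finfun j), m; split=> [t|].
  rewrite !ffunE; have := metric_triangle (x (i t) X) (y t) (q (k t)).
  by have := ix t; have := yk t; rewrite (metric_sym (x (i t) X) (y t)); lra.
split; first exists y; split=> //.
- by move=> t _; rewrite ffunE metric_sym; have := yk t; lra.
- move=> t; rewrite !ffunE; have := metric_triangle (e (i t) X) (w t) (q (j t)).
  have [_ /(_ (i t)) /= wy] := yw t.
  by have := ix t; have := wj t; rewrite (metric_sym (e (i t) X) (w t)) wy; lra.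
- move=> v jv; apply: sV => t _; have := jv t (mem_enum _ _); rewrite ffunE.
  by have := metric_triangle (w t) (q (j t)) (v t); have := wj t; lra.
Qed.

(** The domain of a structure is moved to general position, where isomorphisms
    are restrictions of isometries of [U]. *)
Lemma structure_iso_reduces :
  borel_reducible (@structure_iso R U L) (orbit_equivalence (@structure_act R U L)).
Proof.
have [u0 _] := urysohn_inhabited U.
have [q dq] := separable_dense_seq u0 (@urysohn_separable R U).
have [x [mx Xx dx]] := @measurable_dense_seq R U L q dq.
have [e [me ex egen]] := measurable_generic_embedding dq mx.
have /choice[F FP] (X : M) := transport_exists (Xx^~ X) (dx X) (ex X).
exists F.
  by apply: (measurable_transport dq mx me Xx dx ex) => X;
    have [] := FP X.
have F_graph X : structure_graph X (F X) (transport_graph X (x^~ X) (e^~ X)).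
  by have [F1 F2] := FP X; exact: transport_structure_graph (Xx^~ X) (dx X) (ex X) _ F1 F2.
have Fgen X : generic (struct_dom (F X)) by rewrite (FP X).1.
move=> X Y; rewrite -(generic_structure_iso (Fgen X) (Fgen Y)) !structure_isoP.
split=> -[G XYG]; eexists.
  apply: structure_graph_comp (structure_graph_inv (F_graph X)) _.
  exact: structure_graph_comp XYG (F_graph Y).
apply: structure_graph_comp (F_graph X) _.
exact: structure_graph_comp XYG (structure_graph_inv (F_graph Y)).
Qed.

End reduction.

(** * Countable products of metric spaces *)

Definition countable_power (I : countType) (X : Type) : Type := I -> X.

HB.instance Definition _ (I : countType) (X : Type) :=
  gen_eqMixin (countable_power I X).
HB.instance Definition _ (I : countType) (X : Type) :=
  gen_choiceMixin (countable_power I X).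

Section countable_power.
Context {R : realType} {I : countType} {X : metricType R}.
Local Notation P := (countable_power I X).
Implicit Types a b c : P.

(** The coordinate [i] contributes at most [2^-i], so that convergence is
    convergence of each coordinate; the value [0] keeps the
    supremum meaningful when [I] is empty. *)
Definition power_dist a b : R :=
  sup (0 |` range (fun i => Num.min (2^-1 ^+ pickle i) (mdist (a i) (b i)))).

Lemma power_dist_leP a b (r : R) : 0 <= r ->
  power_dist a b <= r <->
  forall i, Num.min (2^-1 ^+ pickle i) (mdist (a i) (b i)) <= r.
Proof.
move=> r0; split=> [abr i|h]; last first.
  apply: ge_sup; first by exists 0; left.
  by move=> _ [->//|[i _ <-]].
apply: le_trans abr; apply: sup_upper_bound; last by right; exists i.
split; first by exists 0; left.
exists 1 => _ [->//|[j _ <-]]; rewrite ge_min.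
by rewrite exprn_ile1// invf_le1// ler1n.
Qed.

Let dist_ge0 a b : 0 <= power_dist a b.
Proof.
apply: sup_upper_bound; last by left.
split; first by exists 0; left.
exists 1 => _ [->//|[j _ <-]]; rewrite ge_min.
by rewrite exprn_ile1// invf_le1// ler1n.
Qed.

Let dist_xx a : power_dist a a = 0.
Proof.
apply/eqP; rewrite eq_le dist_ge0 andbT; apply/power_dist_leP => // i.
by rewrite mdistxx ge_min lexx orbT.
Qed.

Let dist_positivity a b : power_dist a b = 0 -> a = b.
Proof.
move=> ab0; apply/funext => i; apply: mdist_positivity; apply/eqP.
rewrite eq_le mdist_ge0 andbT.
have : power_dist a b <= 0 by rewrite ab0.
move=> /power_dist_leP/(_ i); rewrite lexx => /(_ isT).
by rewrite ge_min leNgt half_exp_gt0.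
Qed.

Let dist_sym a b : power_dist a b = power_dist b a.
Proof.
by rewrite /power_dist; under eq_fun do rewrite metric_sym.
Qed.

Let dist_triangle b a c :
  power_dist a c <= power_dist a b + power_dist b c.
Proof.
apply/power_dist_leP => [|i]; first exact: addr_ge0.
have /power_dist_leP/(_ i) := lexx (power_dist a b); rewrite dist_ge0 => /(_ isT).
have /power_dist_leP/(_ i) := lexx (power_dist b c); rewrite dist_ge0 => /(_ isT).
have := metric_triangle (a i) (b i) (c i); rewrite !ge_min.
have := half_exp_gt0 R (pickle i); have := dist_ge0 a b; have := dist_ge0 b c.
have := mdist_ge0 (a i) (b i); have := mdist_ge0 (b i) (c i).
move=> ? ? ? ? ? ? /orP[?|?] /orP[?|?]; apply/orP.
- by left; lra.
- by left; lra.
- by left; lra.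
- by right; lra.
Qed.

HB.instance Definition _ :=
  isMetric.Build R P dist_xx dist_positivity dist_sym dist_triangle.

Lemma power_mdistE a b : mdist a b = power_dist a b. Proof. by []. Qed.

Lemma power_mdist_lt (r : R) : 0 < r -> exists n, forall a b,
  (forall i, (pickle i < n)%N -> mdist (a i) (b i) <= r / 2) -> mdist a b < r.
Proof.
move=> r0; have [|n nr] := @half_exp_small R (r / 2); first by lra.
exists n => a b ab; rewrite power_mdistE; suff : power_dist a b <= r / 2 by lra.
apply/power_dist_leP => [|i]; first by lra.
rewrite ge_min; have [iN|ni] := ltnP (pickle i) n; first by rewrite ab// orbT.
apply/orP; left; apply: le_trans (ltW nr); rewrite -(subnKC ni) exprD.
by rewrite ler_piMr// exprn_ile1// invf_le1// ler1n.
Qed.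

Lemma power_mdist_coord (s : seq I) (r : R) : 0 < r ->
  exists2 t : R, 0 < t & forall a b, mdist a b < t ->
    forall i, i \in s -> mdist (a i) (b i) < r.
Proof.
move=> r0; elim: s => [|i s [t t0 st]]; first by exists 1.
exists (Num.min t (Num.min r (2^-1 ^+ pickle i))).
  by rewrite !lt_min t0 r0 half_exp_gt0.
move=> a b; rewrite !lt_min => /and3P[abt abr abi] j.
rewrite inE => /predU1P[->|/st]; last exact.
have /power_dist_leP/(_ i) := lexx (power_dist a b); rewrite dist_ge0 => /(_ isT).
by rewrite -power_mdistE ge_min => /orP[|] ?; lra.
Qed.

Lemma closure_power (A : set P) a (s : seq I) (r : R) : 0 < r -> closure A a ->
  exists2 b, A b & forall i, i \in s -> mdist (a i) (b i) < r.
Proof.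
move=> /(power_mdist_coord s)[t t0 st] /(_ _ (nbhsx_ballx a t t0))[b [Ab]].
by rewrite ballEmdist => /st; exists b.
Qed.

Lemma power_dense (q : nat -> X) : dense_seq q -> exists p : nat -> P, dense_seq p.
Proof.
move=> dq; exists (fun n => fun i => q (nth 0%N (odflt [::] (unpickle n)) (pickle i))).
move=> a r r0; have [n nP] := power_mdist_lt r0.
have /choice[k kP] i : exists k, mdist (a i) (q k) < r / 2 by apply: dq; lra.
pose s := mkseq (fun j => if unpickle j is Some i then k i else 0%N) n.
exists (pickle s); rewrite pickleK /=; apply: nP => i iN.
by rewrite nth_mkseq// pickleK ltW.
Qed.

Lemma power_complete : complete_space X -> complete_space P.
Proof.
move=> cX F PF cF.
have /choice[l lP] i : exists l : X, (fun a : P => a i) @ F --> l.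
  apply: cX => E; rewrite -entourage_ballE => -[r /= r0 rE].
  have [t t0 tr] := power_mdist_coord [:: i] r0.
  have : entourage [set ab : P * P | ball ab.1 t ab.2].
    exact: entourage_ball (PosNum t0).
  move=> /cF[[A B] [FA FB] AB].
  exists ((fun a : P => a i) @` A, (fun a : P => a i) @` B) => /=.
    by split; [apply: filterS FA|apply: filterS FB] => a ?; exists a.
  move=> [_ _] [/= [a Aa <-] [b Bb <-]]; apply: rE => /=; rewrite ballEmdist /=.
  apply: (tr a b); last exact: mem_head.
  have : ball a t b := AB (a, b) (conj Aa Bb).
  by rewrite ballEmdist.
exists (l : P); apply/metricType_numDomainType.fcvgrPdist_lt => r r0.
have [n nP] := power_mdist_lt r0.
have near_l (k : 'I_n) : \forall a \near F,
    if unpickle k is Some i then mdist (l i) (a i) < r / 2 else true.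
  case: (unpickle k) => [i|]; last exact: nearW.
  by apply: (metricType_numDomainType.cvgr_dist_lt (lP i)); lra.
have FF : Filter F := PF.
have := filter_forall FF near_l; apply: filterS => a al.
by apply: nP => i iN; have := al (Ordinal iN); rewrite /= pickleK => /ltW.
Qed.

End countable_power.

(** * The isometry group is Polish *)

Section isometry_group_polish.
Context {R : realType} {U : urysohnSpaceType R}.
Implicit Types (g h : iso U) (s : seq U).

Lemma nbhs_isoP g (A : set (iso U)) : nbhs g A <->
  exists s, exists2 r : R, 0 < r &
    forall h, (forall x, x \in s -> mdist (g x) (h x) < r) -> A h.
Proof.
split=> [|[s [r r0 sA]]].
  move=> [_ [[B oB <-] Bg] BA].
  have /nbhs_ptwsP[s [r r0 sB]] : nbhs (iso_fun g : {ptws U -> U}) B.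
    exact: open_nbhs_nbhs.
  by exists s, r => // h gh; apply: BA; exact: sB.
exists (@iso_fun R U @^-1` [set f : {ptws U -> U} |
  forall x, x \in s -> mdist (g x) (f x) < r]); split.
- by eexists; first exact: (@open_ptws_box R U U s g r).
- by move=> x _ /=; rewrite mdistxx.
- by move=> h; exact: sA.
Qed.

Lemma iso_mul_continuous : continuous (fun p : iso U * iso U => (p.1 * p.2)%g).
Proof.
move=> [g h] A /nbhs_isoP[s [r r0 sA]].
pose B := [set g' : iso U | forall x, x \in map h s -> mdist (g x) (g' x) < r / 2].
pose C := [set h' : iso U | forall x, x \in s -> mdist (h x) (h' x) < r / 2].
have r20 : 0 < r / 2 by lra.
exists (B, C); first by split; apply/nbhs_isoP; [exists (map h s)|exists s];
  exists (r / 2).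
move=> [g' h'] [/= Bg' Ch']; apply: sA => x sx /=.
have := metric_triangle (g (h x)) (g' (h x)) (g' (h' x)).
by have := Bg' (h x) (map_f h sx); have := Ch' x sx; rewrite iso_isometric; lra.
Qed.

(** Pointwise convergence of inverses amounts to pointwise convergence at other
    points. *)
Lemma iso_inv_dist g h x :
  mdist (g^-1%g x) (h^-1%g x) = mdist (g (g^-1%g x)) (h (g^-1%g x)).
Proof.
by rewrite -(iso_isometric h) [h (h^-1%g x)]iso_invK [g (g^-1%g x)]iso_invK metric_sym.
Qed.

Lemma iso_inv_continuous : continuous (fun g : iso U => (g^-1)%g).
Proof.
move=> g A /nbhs_isoP[s [r r0 sA]]; apply/nbhs_isoP.
exists (map (g^-1)%g s), r => // h gh; apply: sA => x sx.
by rewrite iso_inv_dist gh// map_f.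
Qed.

Variable q : nat -> U.
Hypothesis dq : dense_seq q.

(** An isometry [g] is coded by the images of the dense sequence under [g] and
    [g^-1].  The last condition says that two isometric copies of the sequence
    come from maps inverse to each other; all conditions being equalities of
    distances, the codes form a closed set. *)
Definition iso_code_set : set (countable_power (bool * nat)%type U) :=
  [set c | (forall b i j, mdist (c (b, i)) (c (b, j)) = mdist (q i) (q j)) /\
    forall i j, mdist (c (true, j)) (q i) = mdist (q j) (c (false, i))].

Lemma iso_code_closed : closed iso_code_set.
Proof.
move=> c cC; split=> [b i j|i j]; apply/eqP; rewrite -subr_eq0 -normr_eq0 eq_le
  normr_ge0 andbT; apply: le_of_approx => r r0; rewrite add0r;
  have r20 : 0 < r / 2 by [lra].
  have [c' [c'E _] cc'] := closure_power [:: (b, i); (b, j)] r20 cC.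
  have := cc' (b, i) (mem_head _ _); have := cc' (b, j); rewrite !inE eqxx orbT.
  move=> /(_ isT); rewrite -(c'E b).
  have := mdist_abs_sub (c (b, i)) (c' (b, i)) (c (b, j)).
  have := mdist_abs_sub (c (b, j)) (c' (b, j)) (c' (b, i)).
  rewrite (metric_sym (c (b, j)) (c' (b, i))) (metric_sym (c' (b, j)) (c' (b, i))).
  rewrite (metric_sym (c' (b, i)) (c (b, j))) !ler_norml.
  by move=> /andP[? ?] /andP[? ?] ? ?; apply/andP; split; lra.
have [c' [_ c'E] cc'] := closure_power [:: (true, j); (false, i)] r20 cC.
have := cc' (true, j) (mem_head _ _); have := cc' (false, i); rewrite !inE eqxx orbT.
move=> /(_ isT); have := c'E i j.
have := mdist_abs_sub (c (true, j)) (c' (true, j)) (q i).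
have := mdist_abs_sub (c (false, i)) (c' (false, i)) (q j).
rewrite !(metric_sym _ (q j)) !ler_norml.
by move=> /andP[? ?] /andP[? ?] ? ? ?; apply/andP; split; lra.
Qed.

Definition iso_code g : countable_power (bool * nat)%type U :=
  fun bi => if bi.1 then g (q bi.2) else g^-1%g (q bi.2).

Lemma iso_codeP g : iso_code_set (iso_code g).
Proof.
split=> [[] i j|i j] /=; rewrite ?iso_isometric//.
by rewrite /iso_code /= -[RHS](iso_isometric g) [g (g^-1%g _)]iso_invK.
Qed.

Lemma iso_code_inj g h : iso_code g = iso_code h -> g = h.
Proof.
move=> gh; apply: iso_ext => x; apply: mdist_positivity; apply/eqP.
rewrite eq_le mdist_ge0 andbT; apply: le_of_approx => r r0.
have [|n xn] := dq x (e := r / 2); first by lra.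
have gn : g (q n) = h (q n) by exact: (congr1 (fun c => c (true, n)) gh).
have := metric_triangle (g x) (g (q n)) (h x).
by rewrite {2}gn !iso_isometric (metric_sym (q n)); lra.
Qed.

(** Both parts of a code together give a partial isometry with dense domain and
    dense range. *)
Lemma iso_code_surj c : iso_code_set c -> exists g, iso_code g = c.
Proof.
move=> [cE cTF]; pose G : set (U * U) :=
  range (fun i => (q i, c (true, i))) `|` range (fun i => (c (false, i), q i)).
have [||| g gG] := @dense_isometric_graph R U G.
- move=> _ _ [[i _ <-]|[i _ <-]] [[j _ <-]|[j _ <-]] /=; rewrite ?cE//.
  by rewrite metric_sym [RHS]metric_sym cTF.
- by move=> x r /(dq x)[n xn]; exists (q n, c (true, n)) => //; left; exists n.
- by move=> x r /(dq x)[n xn]; exists (c (false, n), q n) => //; right; exists n.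
exists g; apply/funext => -[[] i] /=.
  by apply: (gG (q i, c (true, i))); left; exists i.
rewrite /iso_code /= -(isoK g (c (false, i))); congr (g^-1%g _).
by apply/esym/(gG (c (false, i), q i)); right; exists i.
Qed.

Lemma iso_polish : polish_space R (iso U).
Proof.
have [p dp] := @power_dense R (bool * nat)%type U q dq.
pose f g : set_type iso_code_set := exist _ (iso_code g) (mem_set (iso_codeP g)).
have fbij : bijective f.
  have /choice[k kP] (c : set_type iso_code_set) : exists g, f g = c.
    have [g gc] := iso_code_surj (set_valP c).
    by exists g; apply: val_inj.
  exists k => // g; apply: iso_code_inj.
  by have := congr1 \val (kP (f g)).
exists (set_type iso_code_set : metricType R); split.
- exact: separable_subspace (dense_seq_separable dp).
- exact: complete_subspace iso_code_closed (power_complete (@urysohn_complete R U)).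
exists f => // A; split=> oA.
  apply: open_comp oA => g _ B; rewrite -nbhs_ballE => -[r /= r0 rB].
  have [n nP] := @power_mdist_lt R (bool * nat)%type U r r0.
  apply/nbhs_isoP.
  have r20 : 0 < r / 2 by lra.
  pose pts i := [:: q i; g^-1%g (q i)].
  exists (flatten [seq (if unpickle k is Some bi then pts (bi : bool * nat).2 else [::])
    | k <- iota 0 n]), (r / 2) => // h gh.
  apply: rB; rewrite ballEmdist; apply: nP => -[b i] biN.
  have mem_pts x : x \in pts i -> mdist (g x) (h x) < r / 2.
    move=> xi; apply: gh; apply/flattenP; exists (pts i) => //.
    by apply/mapP; exists (pickle (b, i)); rewrite ?mem_iota// pickleK.
  apply: ltW; case: b {biN} mem_pts => mem_pts /=; rewrite /iso_code /=.
    by apply: mem_pts; rewrite mem_head.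
  by rewrite iso_inv_dist; apply: mem_pts; rewrite !inE eqxx orbT.
rewrite openE => c Ac; have [k fK kK] := fbij; pose g := k c.
have : nbhs g (f @^-1` A).
  by apply: open_nbhs_nbhs; split; rewrite //= /g kK.
move=> /nbhs_isoP[s [r r0 sA]].
have r30 : 0 < r / 3 by lra.
have /choice[m mP] x : exists m, mdist x (q m) < r / 3 by exact: dq.
have [t t0 tP] := @power_mdist_coord R (bool * nat)%type U
  [seq (true, m x) | x <- s] _ r30.
rewrite /interior -nbhs_ballE; exists t => // c'; rewrite ballEmdist => cc'.
have : (f @^-1` A) (k c').
  apply: sA => x sx; have := tP (\val c) (\val c') cc' (true, m x).
  rewrite -{1}(kK c) -{1}(kK c') -/g /= /iso_code /= => /(_ (map_f _ sx)).
  have := mP x; have := metric_triangle (g x) (g (q (m x))) (k c' x).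
  have := metric_triangle (g (q (m x))) (k c' (q (m x))) (k c' x).
  by rewrite !iso_isometric (metric_sym (q (m x)) x); lra.
by rewrite /= kK.
Qed.

End isometry_group_polish.

Lemma iso_polish_group (R : realType) (U : urysohnSpaceType R) :
  polish_group R (iso U).
Proof.
have [u0 _] := urysohn_inhabited U.
have [q dq] := separable_dense_seq u0 (@urysohn_separable R U).
split; [exact: iso_polish dq|exact: iso_mul_continuous|exact: iso_inv_continuous].
Qed.

(** * The Polish space of Lipschitz functions *)

Record pseudometric (R : realType) (Z : Type) := Pseudometric {
  pdist :> Z -> Z -> R;
  pdistxx : forall z, pdist z z = 0;
  pdist_sym : forall y z, pdist y z = pdist z y;
  pdist_triangle : forall x y z, pdist x z <= pdist x y + pdist y z }.

Section lipschitz_space.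
Context {R : realType} {Z : Type}.
Variables (rho : pseudometric R Z) (q : nat -> Z).
Implicit Types (f : Z -> R).

Lemma pdist_ge0 y z : 0 <= rho y z.
Proof. by have := pdist_triangle rho y z y; rewrite pdistxx (pdist_sym rho z); lra. Qed.

Definition nonexpansive f := forall y z, f y <= f z + rho y z.

(** A 1-Lipschitz function on [Z] is coded by its values on the dense sequence
    [q]. *)
Definition lip_set : set (countable_power nat R^o) :=
  [set a | forall i j, a i <= a j + rho (q i) (q j)].

Definition lip_space : Type := set_type lip_set.

HB.instance Definition _ := Metric.copy lip_space (set_type lip_set).

Lemma lip_set0 : lip_set (fun=> 0).
Proof. by move=> i j; rewrite add0r pdist_ge0. Qed.

HB.instance Definition _ := isPointed.Build lip_space
  (exist (fun a => a \in lip_set) _ (mem_set lip_set0)).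

Lemma lip_closed : closed lip_set.
Proof.
move=> a aC i j; apply: le_of_approx => r r0.
have r20 : 0 < r / 2 by lra.
have [b bL ab] := closure_power [:: i; j] r20 aC; have := bL i j.
have := ab i (mem_head _ _); have := ab j; rewrite !inE eqxx orbT => /(_ isT).
by rewrite /mdist /= !ltr_norml => /andP[? ?] /andP[? ?]; lra.
Qed.

Lemma real_dense_seq : exists p : nat -> R^o, dense_seq p.
Proof.
apply: (@separable_dense_seq R R^o 0); exists (range (@ratr R)); last exact: dense_rat.
by apply: (sub_countable (card_image_le _ _)); exact: countableP.
Qed.

Lemma real_complete : complete_space R^o.
Proof.
by move=> F PF cF; exists (lim F); exact: (@cauchy_cvg R^o F PF cF).
Qed.

Lemma lip_dense_seq : exists p : nat -> lip_space, dense_seq p.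
Proof.
have [p dp] := real_dense_seq; have [p' dp'] := @power_dense R nat R^o p dp.
apply: separable_dense_seq; first exact: point.
exact: separable_subspace (dense_seq_separable dp').
Qed.

Lemma lip_complete : complete_space lip_space.
Proof. exact: complete_subspace lip_closed (power_complete real_complete). Qed.

Lemma lip_standard_borel : standard_borel R (borel lip_space).
Proof.
exists (lip_space : metricType R); split.
- by have [p dp] := lip_dense_seq; exact: dense_seq_separable dp.
- exact: lip_complete.
- by exists id => //; exists id.
Qed.

Hypothesis dq : forall z (r : R), 0 < r -> exists n, rho z (q n) < r.

(** The extension formula of McShane. *)
Definition lip_ext (a : lip_space) z : R :=
  sup (range (fun i => (\val a : nat -> R) i - rho z (q i))).

Lemma lip_ext_bounds (a : lip_space) z i :
  (\val a : nat -> R) i - rho z (q i) <= lip_ext a z <=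
  (\val a : nat -> R) i + rho z (q i).
Proof.
have ub j : (\val a : nat -> R) j - rho z (q j) <= (\val a : nat -> R) i + rho z (q i).
  have := set_valP a j i; have := pdist_triangle rho (q j) z (q i).
  by rewrite (pdist_sym rho (q j) z); lra.
apply/andP; split; last first.
  apply: ge_sup; first by exists ((\val a : nat -> R) i - rho z (q i)), i.
  by move=> _ [j _ <-].
apply: sup_upper_bound; last by exists i.
split; first by exists ((\val a : nat -> R) i - rho z (q i)), i.
by exists ((\val a : nat -> R) i + rho z (q i)) => _ [j _ <-].
Qed.

Lemma lip_extE (a : lip_space) i : lip_ext a (q i) = (\val a : nat -> R) i.
Proof.
have := lip_ext_bounds a (q i) i; rewrite pdistxx => /andP[? ?].
by apply/eqP; rewrite eq_le; apply/andP; split; lra.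
Qed.

Lemma lip_ext_nonexpansive a : nonexpansive (lip_ext a).
Proof.
move=> y z; apply: le_of_approx => r r0.
have [|i zi] := dq z (r := r / 2); first by lra.
have /andP[_ ?] := lip_ext_bounds a y i; have /andP[? _] := lip_ext_bounds a z i.
by have := pdist_triangle rho y z (q i); lra.
Qed.

Lemma lip_ext_unique a f : nonexpansive f ->
  (forall i, f (q i) = (\val a : nat -> R) i) -> lip_ext a = f.
Proof.
move=> fL fa; apply/funext => z; apply/eqP; rewrite eq_le.
apply/andP; split; apply: le_of_approx => r r0;
  have [|i zi] := dq z (r := r / 2) => //; try lra;
  have /andP[? ?] := lip_ext_bounds a z i; have := fL z (q i); have := fL (q i) z;
  by rewrite fa (pdist_sym rho (q i)); lra.
Qed.

Lemma lip_restr_subproof f : nonexpansive f -> lip_set (f \o q).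
Proof. by move=> fL i j; exact: fL. Qed.

Definition lip_restr f (fL : nonexpansive f) : lip_space :=
  exist (fun a => a \in lip_set) _ (mem_set (lip_restr_subproof fL)).

Lemma lip_restrK f (fL : nonexpansive f) : lip_ext (lip_restr fL) = f.
Proof. exact: lip_ext_unique. Qed.

Lemma lip_ext_inj a b : lip_ext a = lip_ext b -> a = b.
Proof.
by move=> ab; apply: val_inj; apply/funext => i; rewrite -[LHS]lip_extE ab lip_extE.
Qed.

Lemma measurable_to_lip d (W : measurableType d) (F : W -> borel lip_space) :
  (forall i, mreal (fun w => lip_ext (F w) (q i))) -> measurable_fun setT F.
Proof.
move=> mF; have [p dp] := lip_dense_seq.
have mpF : mpoint p (F : W -> lip_space).
  move=> k; apply: mreal_lt => r.
  apply: (@mprop_eq _ _ _ (fun w => exists m, 0 <= r - 2^-1 ^+ m /\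
    forall i, Num.min (2^-1 ^+ i) `|lip_ext (F w) (q i) - lip_ext (p k) (q i)| <=
      r - 2^-1 ^+ m)).
    have FpE w i : mdist ((\val (F w) : countable_power nat R^o) i)
        ((\val (p k) : countable_power nat R^o) i) =
        `|lip_ext (F w) (q i) - lip_ext (p k) (q i)|.
      by rewrite !lip_extE distrC.
    move=> w; have -> : mdist (F w : lip_space) (p k) =
        power_dist (\val (F w) : countable_power nat R^o) (\val (p k)) by [].
    split=> [Fp|[m [m0 mP]]].
      have [|m mr] := @half_exp_small R
          (r - power_dist (\val (F w) : countable_power nat R^o) (\val (p k))).
        by lra.
      have P0 : 0 <= power_dist (\val (F w) : countable_power nat R^o) (\val (p k)).
        by rewrite -power_mdistE mdist_ge0.
      exists m; split; first by lra.
      move=> i; rewrite -FpE; have : power_dist (\val (F w) : countable_power nat R^o)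
        (\val (p k)) <= r - 2^-1 ^+ m by lra.
      by move=> /power_dist_leP; apply; lra.
    apply: (@le_lt_trans _ _ (r - 2^-1 ^+ m)); last first.
      by have := half_exp_gt0 R m; lra.
    by apply/power_dist_leP => // i; rewrite FpE; exact: mP.
  apply: mprop_ex => m; apply: mprop_and; first exact: mprop_cst.
  apply: mprop_all => i; apply: mprop_le; last exact: mreal_cst.
  apply: measurable_minr; first exact: measurable_cst.
  apply: measurableT_comp => //; apply: measurable_funB; first exact: mF.
  exact: measurable_cst.
apply: measurability; first by [].
move=> _ [V oV <-]; rewrite setTI.
exact: (@mprop_open _ W R lip_space p dp F V mpF oV).
Qed.

Lemma measurable_lip_ext z : mreal (fun a : borel lip_space => lip_ext a z).
Proof.
apply: mreal_lt => r; apply: sub_sigma_algebra.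
suff : @open lip_space [set a | lip_ext a z < r] by [].
rewrite openE => a ar.
have [|i zi] := dq z (r := (r - lip_ext a z) / 4); first by rewrite /= in ar; lra.
have r0 : 0 < (r - lip_ext a z) / 4 by rewrite /= in ar; lra.
have [t t0 tP] := @power_mdist_coord R nat R^o [:: i] _ r0.
rewrite /interior -nbhs_ballE; exists t => // b; rewrite ballEmdist => ab.
have : `|(\val b : nat -> R) i - (\val a : nat -> R) i| < (r - lip_ext a z) / 4.
  exact: tP (\val a) (\val b) ab i (mem_head _ _).
rewrite ltr_norml => /andP[? ?].
have /andP[? _] := lip_ext_bounds a z i; have /andP[_ ?] := lip_ext_bounds b z i.
change (lip_ext b z < r); lra.
Qed.

Section action.
Variables (G : preTopologicalGroupType) (act : G -> Z -> Z).
Hypothesis act1 : forall z, act 1%g z = z.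
Hypothesis actM : forall g h z, act (g * h)%g z = act g (act h z).
Hypothesis act_isom : forall g y z, rho (act g y) (act g z) = rho y z.
Hypothesis act_open : forall y z (r : R), open [set g : G | rho (act g^-1%g y) z < r].

Lemma lip_act_subproof g a : nonexpansive (fun z => lip_ext a (act g^-1%g z)).
Proof. by move=> y z; rewrite -(act_isom g^-1%g y z); exact: lip_ext_nonexpansive. Qed.

Definition lip_act g (a : borel lip_space) : borel lip_space :=
  lip_restr (lip_act_subproof g a).

Lemma lip_actE g a z : lip_ext (lip_act g a) z = lip_ext a (act g^-1%g z).
Proof. by rewrite lip_restrK. Qed.

Lemma lip_act_is_action : is_group_action lip_act.
Proof.
split=> [a|g h a]; apply: lip_ext_inj; apply/funext => z; rewrite !lip_actE.
  by rewrite invg1 act1.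
by rewrite invgM actM.
Qed.

(** The value of the moved function at [q i] is the infimum over [m] of
    [rho (g^-1 (q i)) (q m) + a (q m)]. *)
Lemma lip_act_measurable :
  measurable_fun setT (fun p : borel G * borel lip_space => lip_act p.1 p.2).
Proof.
apply: measurable_to_lip => i; apply: mreal_lt => r.
apply: (@mprop_eq _ _ _ (fun p : borel G * borel lip_space => exists m,
    rho (act p.1^-1%g (q i)) (q m) + lip_ext p.2 (q m) < r)).
  move=> p; rewrite lip_actE; split=> [pr|[m mr]].
    have [|m zm] := dq (act p.1^-1%g (q i))
        (r := (r - lip_ext p.2 (act p.1^-1%g (q i))) / 2); first by lra.
    exists m; have := lip_ext_nonexpansive p.2 (q m) (act p.1^-1%g (q i)).
    by rewrite (pdist_sym rho (q m)); lra.
  by have := lip_ext_nonexpansive p.2 (act p.1^-1%g (q i)) (q m); lra.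
apply: mprop_ex => m; apply: mprop_lt; last exact: mreal_cst.
apply: measurable_funD.
  have mg : mreal (fun g : borel G => rho (act g^-1%g (q i)) (q m)).
    by apply: mreal_lt => t; apply: sub_sigma_algebra; exact: act_open.
  exact: (measurableT_comp mg (@measurable_fst _ _ (borel G) (borel lip_space))).
exact: (measurableT_comp (measurable_lip_ext (q m))
  (@measurable_snd _ _ (borel G) (borel lip_space))).
Qed.

End action.

End lipschitz_space.

(** * Structures as Lipschitz functions *)

Definition symbol_code (L : signature) : L -> nat :=
  match L return L -> nat with
  | FinSignature s => fun n : 'I_(size s) => n : nat
  | InfSignature l => fun n => n
  end.

Lemma symbol_code_inj (L : signature) : injective (@symbol_code L).
Proof. by case: L => [s|l] //=; exact: val_inj. Qed.

(** The domain counts as a unary relation, with index [0]. *)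
Definition relation_dim (L : signature) (k : nat) : nat :=
  if k is m.+1 then
    match L with FinSignature s => nth 0%N s m | InfSignature l => l m end
  else 1%N.

Lemma relation_dim_code (L : signature) (n : L) :
  relation_dim L (symbol_code n).+1 = arity n.
Proof. by case: L n. Qed.

Section structure_function.
Context {R : realType} {U : urysohnSpaceType R} {L : signature}.
Local Notation M := (structure_space U L).
Local Notation Z := (nat * (nat -> U))%type.
Local Notation dim := (relation_dim L).
Implicit Types (X Y : M) (x y z : Z) (g h : iso U).

(** The points of [Z] with first component [k] stand for the tuples of length
    [dim k] in [U], only the first [dim k] terms of a sequence being relevant;
    distances are capped so that tuples of different relations can be at
    distance [1]. *)
Definition tuple_dist y z : R :=
  if y.1 == z.1 then
    Num.min 1 (\big[Num.max/0]_(i < dim y.1) mdist (y.2 i) (z.2 i))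
  else 1.

Lemma tuple_dist_ltP y z (r : R) : tuple_dist y z < r <-> 1 < r \/
  [/\ 0 < r, y.1 = z.1 & forall i, (i < dim y.1)%N -> mdist (y.2 i) (z.2 i) < r].
Proof.
rewrite /tuple_dist; case: eqP => [yz|nyz]; last first.
  by split=> [|[//|[_ /nyz]//]]; left.
rewrite gt_min; split=> [/orP[|/bigmax_ltP[r0 yzr]]|[->//|[r0 _ yzr]]].
- by left.
- by right; split=> // i iN; exact: (yzr (Ordinal iN)).
- by apply/orP; right; apply/bigmax_ltP; split=> // i _; exact: yzr.
Qed.

Lemma tuple_dist_le0 z : tuple_dist z z <= 0.
Proof.
apply: le_of_approx => r r0; apply: ltW; apply/tuple_dist_ltP; right.
by rewrite add0r; split=> // i _; rewrite mdistxx.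
Qed.

Lemma tuple_dist_ge0 y z : 0 <= tuple_dist y z.
Proof.
rewrite leNgt; apply/negP => /tuple_dist_ltP[|[]]; last by rewrite ltxx.
by rewrite ltr10.
Qed.

Lemma tuple_distxx z : tuple_dist z z = 0.
Proof. by apply/eqP; rewrite eq_le tuple_dist_le0 tuple_dist_ge0. Qed.

Lemma tuple_dist_sym y z : tuple_dist y z = tuple_dist z y.
Proof.
rewrite /tuple_dist eq_sym; case: eqP => // ->.
by under eq_bigr do rewrite metric_sym.
Qed.

Lemma tuple_dist_triangle x y z :
  tuple_dist x z <= tuple_dist x y + tuple_dist y z.
Proof.
apply: le_of_approx => r r0; apply: ltW; apply/tuple_dist_ltP.
have xy0 := tuple_dist_ge0 x y; have yz0 := tuple_dist_ge0 y z.
have [|xy1|[_ exy xyi]] := (tuple_dist_ltP x y (tuple_dist x y + r / 2)).1.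
- by lra.
- by left; lra.
have [|yz1|[_ eyz yzi]] := (tuple_dist_ltP y z (tuple_dist y z + r / 2)).1.
- by lra.
- by left; lra.
right; split=> [||i iN]; [by lra|by rewrite exy|].
have := xyi i iN; have := yzi i; rewrite -exy => /(_ iN).
by have := metric_triangle (x.2 i) (y.2 i) (z.2 i); lra.
Qed.

Definition tuple_pseudometric : pseudometric R Z :=
  Pseudometric tuple_distxx tuple_dist_sym tuple_dist_triangle.
Local Notation rho := tuple_pseudometric.

Definition tuple_seq (q : nat -> U) (n : nat) : Z :=
  let: (k, t) := odflt (0%N, [::]) (unpickle n) : nat * seq nat in
  (k, fun i => q (nth 0%N t i)).

Lemma tuple_seq_dense q z (r : R) : dense_seq q -> 0 < r ->
  exists n, rho z (tuple_seq q n) < r.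
Proof.
move=> dq r0; have /choice[m mP] i : exists m, mdist (z.2 i) (q m) < r by exact: dq.
exists (pickle (z.1, mkseq m (dim z.1))); rewrite /tuple_seq pickleK /=.
by apply/tuple_dist_ltP; right; split=> // i iN /=; rewrite nth_mkseq.
Qed.

Definition structure_points X : set Z :=
  [set z | (z.1 = 0%N /\ struct_dom X (z.2 0%N)) \/
    exists2 n : L, z.1 = (symbol_code n).+1 & struct_rel X n (fun i => z.2 i)].

Lemma structure_points_dom X (u : nat -> U) :
  structure_points X (0%N, u) <-> struct_dom X (u 0%N).
Proof. by split=> [[[]//|[]//]|?]; left. Qed.

Lemma structure_points_rel X (n : L) (u : nat -> U) :
  structure_points X ((symbol_code n).+1, u) <-> struct_rel X n (fun i => u i).
Proof.
split=> [[[]//|[m /= [/symbol_code_inj <-]]//]|Xu].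
by right; exists n.
Qed.

Lemma structure_points_ext X Y : structure_points X = structure_points Y -> X = Y.
Proof.
move=> XY; apply: structure_ext => [|n]; apply/seteqP; split=> u.
- move/(structure_points_dom X (fun=> u)); rewrite XY.
  exact: (structure_points_dom Y (fun=> u)).1.
- move/(structure_points_dom Y (fun=> u)); rewrite -XY.
  exact: (structure_points_dom X (fun=> u)).1.
all: have [u0 _] := urysohn_inhabited U;
  pose pad i := if insub i is Some j then u j else u0;
  have -> : u = (fun i : 'I_(arity n) => pad i)
    by [apply/funext => i; rewrite /pad valK].
- move/(structure_points_rel X n pad); rewrite XY.
  exact: (structure_points_rel Y n pad).1.
- move/(structure_points_rel Y n pad); rewrite -XY.
  exact: (structure_points_rel X n pad).1.
Qed.

(** The distance to the set of points of a structure, which determines it as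
    this set is closed; this turns the action on closed sets into an action on
    functions. *)
Definition structure_fun X z : R := inf [set rho z y | y in structure_points X].

Lemma structure_points_neq0 X : structure_points X !=set0.
Proof.
have [u Xu] := struct_dom_neq0 X.
by exists (0%N, fun=> u); apply/structure_points_dom.
Qed.

Lemma structure_fun_ltP X z (r : R) :
  structure_fun X z < r <-> exists2 y, structure_points X y & rho z y < r.
Proof.
have [y0 Xy0] := structure_points_neq0 X.
have hi : has_inf [set rho z y | y in structure_points X].
  split; first by exists (rho z y0), y0.
  by exists 0 => _ [y _ <-]; exact: tuple_dist_ge0.
split=> [zr|[y Xy zy]].
  have [|_ [y Xy <-] zy] := inf_adherent (eps := r - structure_fun X z) _ hi.
    by lra.
  by exists y => //; move: zy; rewrite -/(structure_fun X z); lra.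
by apply: le_lt_trans zy; apply: (ge_inf hi.2); exists y.
Qed.

Lemma structure_fun_nonexpansive X : nonexpansive rho (structure_fun X).
Proof.
move=> y z; apply: le_of_approx => r r0; apply: ltW; apply/structure_fun_ltP.
have [|w Xw zw] := (structure_fun_ltP X z (structure_fun X z + r)).1; first by lra.
by exists w => //; have := pdist_triangle rho y z w; lra.
Qed.

Lemma structure_fun_le0 X z : structure_fun X z <= 0 <-> structure_points X z.
Proof.
split=> [z0|Xz]; last first.
  apply: le_of_approx => r r0; rewrite add0r; apply/ltW/structure_fun_ltP.
  by exists z => //; rewrite pdistxx.
have near_z (r : R) : 0 < r -> r <= 1 -> exists2 y, structure_points X y &
    z.1 = y.1 /\ forall i, (i < dim z.1)%N -> mdist (z.2 i) (y.2 i) < r.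
  move=> r0 r1; have [|y Xy] := (structure_fun_ltP X z r).1; first by lra.
  by move=> /tuple_dist_ltP[|[]]; [lra|exists y].
have [y1 Xy1 [zy1 _]] := near_z 1 ltr01 (lexx 1).
case: z zy1 near_z z0 => k u /= ku near_u _.
case: Xy1 => [[y10 _]|[n y1n _]].
  rewrite ku y10 in near_u *; apply/structure_points_dom.
  apply: closed_mdist (@struct_dom_closed _ _ _ X) _ => r r0.
  have [||[k' v] Xv [/= k'0 uv]] := near_u (Num.min r 1).
  - by rewrite lt_min r0 ltr01.
  - by rewrite ge_min lexx orbT.
  exists (v 0%N); first by apply/structure_points_dom; rewrite k'0.
  by have := uv 0%N isT; rewrite lt_min => /andP[].
rewrite ku y1n in near_u *; apply/structure_points_rel.
apply: (@struct_rel_closed _ _ _ X n) => A /nbhs_ptwsP[s [r r0 sA]].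
have [||[k' v] Xv [/= k'n uv]] := near_u (Num.min r 1).
- by rewrite lt_min r0 ltr01.
- by rewrite ge_min lexx orbT.
exists (fun i => v i); split; first by apply/structure_points_rel; rewrite k'n.
apply: sA => i _.
have iN : (i < dim (symbol_code n).+1)%N by rewrite relation_dim_code.
by have := uv i iN; rewrite lt_min => /andP[].
Qed.

Lemma structure_fun_inj X Y : structure_fun X = structure_fun Y -> X = Y.
Proof.
move=> XY; apply: structure_points_ext; apply/seteqP; split=> z.
  by move/structure_fun_le0; rewrite XY => /structure_fun_le0.
by move/structure_fun_le0; rewrite -XY => /structure_fun_le0.
Qed.

Lemma structure_fun_mreal z : mreal (fun X : M => structure_fun X z).
Proof.
apply: mreal_lt => r.
apply: (@mprop_eq _ _ _ (fun X => exists2 y, structure_points X y & rho z y < r)).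
  by move=> X; exact: structure_fun_ltP.
have [r1|r1] := ltP 1 r.
  apply: (@mprop_eq _ _ _ (fun=> True)); last exact: mprop_cst.
  move=> X; split=> // _; have [y Xy] := structure_points_neq0 X; exists y => //.
  by apply/tuple_dist_ltP; left.
have [r0|r0] := ltP 0 r; last first.
  apply: (@mprop_eq _ _ _ (fun=> False)); last exact: mprop_cst.
  by move=> X; split=> // -[y _]; have := tuple_dist_ge0 z y; rewrite /=; lra.
case: z => -[|k] u.
  apply: (@mprop_eq _ _ _ (fun X => struct_dom X `&` [set v | mdist (u 0%N) v < r] !=set0)).
    move=> X; split=> [[[k v] Xv /tuple_dist_ltP[|[_ /= k0 uv]]]|[v [Xv uv]]].
    - by rewrite ltNge r1.
    - by exists (v 0%N); split; [apply/structure_points_dom; rewrite k0|exact: uv].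
    exists (0%N, fun=> v); first exact/structure_points_dom.
    by apply/tuple_dist_ltP; right; split=> // -[].
  by apply: mprop_dom_hits; exact: open_mball.
have [[n kn]|nk] := pselect (exists n : L, k = symbol_code n); last first.
  apply: (@mprop_eq _ _ _ (fun=> False)); last exact: mprop_cst.
  move=> X; split=> // -[y Xy /tuple_dist_ltP[|[_ /= ky _]]]; first by rewrite ltNge r1.
  case: Xy => [[y0 _]|[n yn _]]; first by rewrite y0 in ky.
  by apply: nk; exists n; move: ky; rewrite yn => -[].
rewrite {}kn; apply: (@mprop_eq _ _ _ (fun X => struct_rel X n `&`
  [set w : {ptws 'I_(arity n) -> U} |
    forall i, i \in enum 'I_(arity n) -> mdist (u i) (w i) < r] !=set0)).
  move=> X; split=> [[[k' v] Xv /tuple_dist_ltP[|[_ /= k'n uv]]]|[w [Xw uw]]].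
  - by rewrite ltNge r1.
  - exists (fun i => v i); split; first by apply/structure_points_rel; rewrite k'n.
    move=> i _; have iN : (i < dim (symbol_code n).+1)%N by rewrite relation_dim_code.
    exact: uv i iN.
  pose v i := if insub i is Some j then w j else u i.
  exists ((symbol_code n).+1, v).
    apply/structure_points_rel; congr (struct_rel X n _): Xw.
    by apply/funext => i; rewrite /v valK.
  apply/tuple_dist_ltP; right; split=> // i i_dim.
  have iN : (i < arity n)%N by rewrite -relation_dim_code.
  by rewrite /= /v insubT /=; apply: (uw (Ordinal iN)); rewrite mem_enum.
apply: mprop_rel_hits.
exact: (@open_ptws_box R _ U (enum 'I_(arity n)) (fun i => u i) r).
Qed.

Definition tuple_act g z : Z := (z.1, fun i => g (z.2 i)).

Lemma tuple_act1 z : tuple_act 1%g z = z. Proof. by case: z. Qed.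

Lemma tuple_actM g h z : tuple_act (g * h)%g z = tuple_act g (tuple_act h z).
Proof. by []. Qed.

Lemma tuple_actK g z : tuple_act g (tuple_act g^-1%g z) = z.
Proof. by rewrite -tuple_actM mulgV tuple_act1. Qed.

Lemma tuple_act_isom g y z : rho (tuple_act g y) (tuple_act g z) = rho y z.
Proof.
rewrite /= /tuple_dist /=; case: eqP => // _.
by under eq_bigr do rewrite iso_isometric.
Qed.

Lemma tuple_act_open y z (r : R) :
  open [set g : iso U | rho (tuple_act g^-1%g y) z < r].
Proof.
have rhoE g : rho (tuple_act g^-1%g y) z = rho y (tuple_act g z).
  by rewrite -(tuple_act_isom g) tuple_actK.
rewrite openE => g gr0; apply/nbhs_isoP.
have gr : rho y (tuple_act g z) < r by rewrite -rhoE; exact: gr0.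
exists [seq z.2 i | i <- iota 0 (dim z.1)], (r - rho y (tuple_act g z)).
  by lra.
move=> h gh; suff hr : rho y (tuple_act h z) < r.
  by change (rho (tuple_act h^-1%g y) z < r); rewrite rhoE.
have : rho (tuple_act g z) (tuple_act h z) < r - rho y (tuple_act g z).
  apply/tuple_dist_ltP; right; split=> //=; first by move: gr; rewrite /=; lra.
  by move=> i iN; apply: gh; rewrite map_f// mem_iota.
by have := pdist_triangle rho y (tuple_act g z) (tuple_act h z); lra.
Qed.

Lemma structure_points_act g X z :
  structure_points (structure_act g X) (tuple_act g z) <-> structure_points X z.
Proof.
split.
  case=> /= [[z0 [u Xu gu]]|[n zn [w Xw gw]]].
    left; split=> //; suff <- : u = z.2 0%N by [].
    by rewrite -(isoK g u) gu isoK.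
  right; exists n => //; suff <- : w = (fun i => z.2 i) by [].
  apply/funext => i; rewrite -(isoK g (w i)) -[RHS](isoK g).
  by congr (iso_inv g _); exact: (congr1 (fun f => f i) gw).
case=> [[z0 Xz]|[n zn Xz]]; [left|right].
  by split=> //; exists (z.2 0%N).
by exists n => //; exists (fun i => z.2 i).
Qed.

Lemma structure_fun_act g X z :
  structure_fun (structure_act g X) z = structure_fun X (tuple_act g^-1%g z).
Proof.
have lt_equiv r : structure_fun (structure_act g X) z < r <->
    structure_fun X (tuple_act g^-1%g z) < r.
  rewrite !structure_fun_ltP; split=> -[y Xy zy].
    exists (tuple_act g^-1%g y); last by rewrite tuple_act_isom.
    by apply/(structure_points_act g); rewrite tuple_actK.
  exists (tuple_act g y); first exact/structure_points_act.
  by rewrite -(tuple_act_isom g^-1%g) -tuple_actM mulVg tuple_act1.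
apply/eqP; rewrite eq_le; apply/andP; split; rewrite leNgt; apply/negP.
  by move/lt_equiv; rewrite ltxx.
by move/lt_equiv; rewrite ltxx.
Qed.

End structure_function.

Section conclusion.
Context {R : realType} {U : urysohnSpaceType R} {L : signature}.

Lemma borel_reducible_trans d1 d2 d3 (T1 : measurableType d1)
    (T2 : measurableType d2) (T3 : measurableType d3)
    (E1 : T1 -> T1 -> Prop) (E2 : T2 -> T2 -> Prop) (E3 : T3 -> T3 -> Prop) :
  borel_reducible E1 E2 -> borel_reducible E2 E3 -> borel_reducible E1 E3.
Proof.
move=> [f mf fE] [h mh hE]; exists (h \o f); first exact: measurableT_comp.
by move=> x y; rewrite fE hE.
Qed.

(** The map sending a structure to its distance function is equivariant, Borel and
    injective, so that it reduces one orbit equivalence relation to the other. *)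
Lemma structure_act_below :
  below_group_action R (orbit_equivalence (@structure_act R U L)).
Proof.
have [u0 _] := urysohn_inhabited U.
have [q dq] := separable_dense_seq u0 (@urysohn_separable R U).
pose rho := @tuple_pseudometric R U L; pose p := @tuple_seq R U q.
have dp z (r : R) : 0 < r -> exists n, rho z (p n) < r.
  exact: (tuple_seq_dense z dq).
pose act := lip_act dp (@tuple_act_isom R U L).
exists (iso U), _, (borel (lip_space rho p)), act; split.
- exact: iso_polish_group.
- exact: lip_standard_borel.
- exact: (lip_act_is_action dp (@tuple_act1 R U) (@tuple_actM R U)
    (@tuple_act_isom R U L)).
- exact: (lip_act_measurable dp (@tuple_act_isom R U L) (@tuple_act_open R U L)).
exists (fun X => lip_restr p (structure_fun_nonexpansive X)).
  apply: measurable_to_lip => i.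
  have restrE : (fun X : structure_space U L =>
      lip_ext (lip_restr p (structure_fun_nonexpansive X)) (p i)) =
      (fun X => structure_fun X (p i)).
    by apply: functional_extensionality_dep => X; rewrite (lip_restrK dp).
  by rewrite restrE; exact: structure_fun_mreal.
have actE g X : act g (lip_restr p (structure_fun_nonexpansive X)) =
    lip_restr p (structure_fun_nonexpansive (structure_act g X)).
  apply: lip_ext_inj; apply/funext => z.
  by rewrite (lip_actE dp) !(lip_restrK dp) structure_fun_act.
move=> X Y; split=> [[g <-]|[g]]; first by exists g; exact: actE.
rewrite actE => XY; exists g; apply: structure_fun_inj.
by rewrite -(lip_restrK dp (structure_fun_nonexpansive (structure_act g X))) XY
  (lip_restrK dp).
Qed.

End conclusion.

Theorem theorem2p2 (R : realType) (U : urysohnSpaceType R) (L : signature) :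
  borel_reducible (@structure_iso R U L) (orbit_equivalence (@structure_act R U L))
  /\ below_group_action R (@structure_iso R U L).
Proof.
split; first exact: structure_iso_reduces.
have [G [d [Y [act [GP YP actP mact red]]]]] := @structure_act_below R U L.
exists G, d, Y, act; split=> //.
exact: borel_reducible_trans (@structure_iso_reduces R U L) red.
Qed.
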